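(* For every integer $k\ge 2$, as $n\to\infty$, $$H_n(C_{2k})\le n^{\left(1-\frac{2}{3k}\right)n+o(n)}.$$
   Context: For a graph $G$, $H_n(G)$ denotes the maximum number of Hamilton paths in the complete graph $K_n$ such that the union of any two of them contains $G$ as a subgraph. $C_m$ denotes the cycle of length $m$. *)

(* Defs.v *)
From mathcomp Require Import all_boot all_order all_fingroup.
Set Implicit Arguments. Unset Strict Implicit. Unset Printing Implicit Defensive.

(* Vertices of K_n are 'I_n; an edge is a 2-element set {u,v}; a (simple)
   graph on 'I_n is given by its edge set : {set {set 'I_n}}. *)

Definition ham_edges (n : nat) (s : 'S_n) : {set {set 'I_n}} :=
  [set [set s i; s j] | i in 'I_n, j in 'I_n & (val j == (val i).+1)%N].

Definition is_ham_path (n : nat) (E : {set {set 'I_n}}) : Prop :=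
  exists s : 'S_n, E = ham_edges s.

Definition contains_cycle (n m : nat) (E : {set {set 'I_n}}) : Prop :=
  exists f : 'I_m -> 'I_n, injective f /\
    forall i j : 'I_m, (val j == ((val i).+1 %% m))%N -> [set f i; f j] \in E.

Definition cycle_intersecting (n m : nat) (F : {set {set {set 'I_n}}}) : Prop :=
  (forall P, P \in F -> is_ham_path P) /\
  (forall P Q, P \in F -> Q \in F -> P != Q -> contains_cycle m (P :|: Q)).

(* Main.v *)
Require Import Defs.
From Stdlib Require Import Reals Lra.
From mathcomp Require Import all_boot all_order all_fingroup all_algebra.
From mathcomp Require Import zify ring.
Set Implicit Arguments. Unset Strict Implicit. Unset Printing Implicit Defensive.

(* If [PP] is a set of Hamilton paths, viewed as orderings of the vertices, no two
   of which have a union containing [C_{2k}], then the permutations carrying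
   members of [PP] to members of [F] are all distinct, so [#|F| * #|PP| <= n!].
   It remains to build [PP] of size [n ^ ((2 / (3 k) - o(1)) n)].

   The paths of [PP] run through copies [V x {0, ..., T}] of a set [V], where a
   perfect matching taken from a [d]-regular bipartite graph joins consecutive
   layers, and return to layer 0 along [2 k + 1] vertices of degree two. Different
   pairs of layers use disjoint sets of colours of one bipartite graph without
   short cycles, so that a [C_{2k}] in the union would project to a closed
   non-backtracking walk of length [2 k] in that graph. Fixing, by pigeonhole, the
   composite of the matchings of a path makes the connecting edges common to all
   paths and costs only a factor [n ^ (n / T)].

   The graph is of the type of Lubotzky, Phillips and Sarnak: [V] is the group of
   quaternions of norm 1 modulo [Q = 5 ^ r], and the neighbours of a vertex are
   its products with about [p] integer quaternions of norm [M], a small multiple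
   of the prime [p]. A closed walk of length [2 k] produces an integer quaternion
   of norm [M ^ (2 k)] congruent to [M ^ k] modulo [Q]; when [Q ^ 2 > 2 M ^ k] it
   equals [M ^ k] and vanishes modulo [p], which a non-backtracking product does
   not. Thus [#|V|] is of order [Q ^ 3], i.e. [p ^ (3 k / 2)].

   No expansion is needed: a [d]-regular bipartite graph on [n + n] vertices with
   [d = 2 ^ m] has at least [(d / 16) ^ n] perfect matchings. Indeed it splits into
   two [d / 2]-regular graphs in many ways, hence has many 1-factorisations, and
   each of these is a [d]-tuple of perfect matchings. *)

(** * Perfect matchings of regular bipartite graphs *)

Section TwoInvolutions.
Variables (E : finType) (s t : E -> E).
Hypotheses (sK : involutive s) (tK : involutive t).
Hypotheses (s_fpf : forall e, s e != e) (t_fpf : forall e, t e != e).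

Let u := s \o t.
Let w := t \o s.

Let wK : cancel u w. Proof. by move=> e; rewrite /w /u /= sK tK. Qed.
Let uK : cancel w u. Proof. by move=> e; rewrite /w /u /= tK sK. Qed.
Let u_inj : injective u := can_inj wK.

Let iterK n x : iter n w (iter n u x) = x.
Proof. by elim: n x => //= n IH x; rewrite -iterS iterSr /= wK IH. Qed.

Let s_iter n e : s (iter n u e) = iter n w (s e).
Proof. by elim: n => //= n IH; rewrite -IH /u /w /= !sK. Qed.

(** [s] conjugates [u] to its inverse. If [s e] were [u ^ m e], then with [j = m./2] the point
    [u ^ j e] would be fixed by [s] for even [m] and by [t] for odd [m]. *)
Lemma involution_swaps_orbits e : ~~ fconnect u e (s e).
Proof.
apply/negP=> /iter_findex; set m := findex _ _ _ => em.
have := odd_double_half m; set j := m./2; case: (odd m) => /= mE; last first.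
  have := s_fpf (iter j u e).
  by rewrite s_iter -em -mE add0n -addnn iterD iterK eqxx.
have := t_fpf (iter j u e).
have -> : t (iter j u e) = s (iter j.+1 u e) by rewrite iterS /u /= sK.
rewrite s_iter -em.
have -> : m = (j.+1 + j)%N by lia.
by rewrite iterD iterK eqxx.
Qed.

(** Joining each [e] to [s e] and to [t e] gives even cycles, each made of a [u]-orbit and its
    distinct image under [s]. The colour of [e] records whether its own orbit is the one whose root
    has the smaller rank. *)
Lemma involutions_common_coloring :
  exists B : {set E}, forall e, (s e \in B) = (e \notin B) /\ (t e \in B) = (e \notin B).
Proof.
have sym := fconnect_sym u_inj.
pose rk e := enum_rank (froot u e).
have rkE e f : fconnect u e f -> rk e = rk f.
  by rewrite /rk => /(fingraph.rootP sym) ->.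
have rkN e : rk e != rk (s e).
  apply: contra (involution_swaps_orbits e) => /eqP /enum_rank_inj h.
  exact/(fingraph.rootP sym).
pose c e := (rk e < rk (s e))%N.
have cs e : c (s e) = ~~ c e.
  rewrite /c sK; have := rkN e; rewrite -val_eqE /=; lia.
have cu e : c (u e) = c e.
  rewrite /c -(rkE e (u e)) ?fconnect1 //.
  have -> : s (u e) = w (s e) by rewrite (s_iter 1).
  by rewrite (rkE (w (s e)) (s e)) // -{2}[s e]uK fconnect1.
exists [set e | c e] => e; rewrite !inE cs; split => //.
by rewrite -(cu e) /u /= cs negbK.
Qed.

End TwoInvolutions.

(** * Subsets that split every block of a partition evenly *)

Section Halvings.
Variable E : finType.
Implicit Types (l r : E -> nat) (B : {set E}).

(** Partitions of [E] are encoded by labellings, so that refining one is a pointwise change of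
    labels. *)
Definition part l e := [set x | l x == l e].

Definition halvings l : {set {set E}} :=
  [set B | [forall e, #|B :&: part l e|.*2 == #|part l e|]].

(** One more than the maximal label is a label not in use, so [a] and [b] become a block of their
    own. *)
Definition split_off l a b (x : E) :=
  if x \in [set a; b] then (\max_y l y).+1 else l x.

Lemma halvingsP l B :
  reflect (forall e, #|B :&: part l e|.*2 = #|part l e|) (B \in halvings l).
Proof. by rewrite inE; apply: (iffP forallP) => h e; apply/eqP; rewrite h. Qed.

Lemma part_split_off_in l a b e :
  e \in [set a; b] -> part (split_off l a b) e = [set a; b].
Proof.
move=> eP; apply/setP=> x; rewrite [LHS]inE /split_off eP.
case: ifP => [|_]; first by rewrite eqxx.
by apply/negbTE; rewrite neq_ltn ltnS (leq_bigmax (F := l)).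
Qed.

Lemma part_split_off_out l a b e :
  e \notin [set a; b] -> part (split_off l a b) e = part l e :\: [set a; b].
Proof.
move=> eP; apply/setP=> x; rewrite in_setD [LHS]in_set [x \in part l e]in_set /split_off (negbTE eP).
case: ifP => //= _; apply/negbTE.
by rewrite eq_sym neq_ltn ltnS (leq_bigmax (F := l)).
Qed.

Lemma card_setI2 B a b : a != b -> #|B :&: [set a; b]| = (a \in B) + (b \in B).
Proof.
move=> ab; rewrite setIUr cardsU.
have -> : (B :&: [set a]) :&: (B :&: [set b]) = set0.
  by apply/setP=> x; rewrite !inE; case: eqP => [->|]; rewrite ?(negbTE ab) ?andbF.
have c1 x : #|B :&: [set x]| = (x \in B).
  case: (boolP (x \in B)) => xB; first by rewrite (setIidPr _) ?cards1 ?sub1set.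
  by rewrite (_ : B :&: _ = set0) ?cards0 //; apply/setP=> y; rewrite !inE;
     case: eqP => [->|]; rewrite ?(negbTE xB) ?andbF.
by rewrite !c1 cards0 subn0.
Qed.

Lemma halvings_split_off l a b B : a != b -> l a = l b ->
  (B \in halvings (split_off l a b)) = (B \in halvings l) && ((a \in B) (+) (b \in B)).
Proof.
move=> ab lab; set P := [set a; b].
have aP : a \in P by rewrite !inE eqxx.
have cP : #|P| = 2 by rewrite cards2 ab.
have split X e : l e = l a -> #|X :&: part l e| = #|X :&: P| + #|X :&: (part l e :\: P)|.
  move=> le; rewrite -(cardsID P (X :&: part l e)) -setIA setIDA.
  congr (#|_ :&: _| + _); apply/setIidPr/subsetP => x.
  by rewrite !inE le => /orP[]/eqP ->; rewrite ?lab.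
have split1 e : l e = l a -> #|part l e| = 2 + #|part l e :\: P|.
  by move=> /(split setT); rewrite !setTI cP.
apply/halvingsP/andP=> [h|[/halvingsP h x]].
  have x : (a \in B) (+) (b \in B).
    move: (h a); rewrite part_split_off_in // card_setI2 // cP.
    by case: (a \in B); case: (b \in B).
  have c1 : #|B :&: P| = 1.
    by rewrite card_setI2 //; move: x; case: (a \in B); case: (b \in B).
  split=> //; apply/halvingsP => e.
  have [le|le] := eqVneq (l e) (l a).
    rewrite split // split1 // c1.
    (* If the pair is the whole block, nothing is left at which the hypothesis [h] could be
       evaluated. *)
    have [f0|[y yP]] := set_0Vmem (part l e :\: P).
      by rewrite f0 setI0 cards0.
    move: yP; rewrite in_setD => /andP[yP ye].
    have := h y; rewrite part_split_off_out // -/P.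
    have -> : part l y = part l e.
      by apply/setP=> z; move: ye; rewrite !inE => /eqP ->.
    lia.
  have eP : e \notin P by apply: contra le; rewrite !inE => /orP[]/eqP ->; rewrite ?lab.
  have := h e; rewrite part_split_off_out // -/P.
  suff -> : part l e :\: P = part l e by [].
  apply/setDidPl; rewrite disjoint_subset; apply/subsetP => z; rewrite !inE => /eqP ze.
  by apply: contra le => /orP[]/eqP zE; rewrite -ze zE ?lab.
move=> e; have [eP|eP] := boolP (e \in P).
  rewrite part_split_off_in // card_setI2 // cP.
  by move: x; case: (a \in B); case: (b \in B).
have c1 : #|B :&: P| = 1.
  by rewrite card_setI2 //; move: x; case: (a \in B); case: (b \in B).
rewrite part_split_off_out // -/P.
have [le|le] := eqVneq (l e) (l a).
  by have := h e; rewrite split // split1 // c1; lia.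
suff -> : part l e :\: P = part l e by [].
apply/setDidPl; rewrite disjoint_subset; apply/subsetP => z; rewrite !inE => /eqP ze.
by apply: contra le => /orP[]/eqP zE; rewrite -ze zE ?lab.
Qed.

(** Double counting: a set that halves the block of [a] separates [a] from exactly half of this
    block. The set [Y] allows both all halvings and those that also halve a second partition. *)
Lemma sum_halvings_split_off l a (Y : {set {set E}}) :
  (\sum_(b in part l a :\ a) #|halvings (split_off l a b) :&: Y|).*2
    = #|part l a| * #|halvings l :&: Y|.
Proof.
have -> : \sum_(b in part l a :\ a) #|halvings (split_off l a b) :&: Y|
   = \sum_(B in halvings l :&: Y) #|[set b in part l a :\ a | (a \in B) (+) (b \in B)]|.
  under eq_bigr => b _ do rewrite -sum1_card big_mkcond /=.
  under [RHS]eq_bigr => B _ do rewrite -sum1_card big_mkcond /=.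
  rewrite exchange_big /= [RHS]big_mkcond /=; apply: eq_bigr => B _.
  case: ifP => hB.
    rewrite big_mkcond /=; apply: eq_bigr => b _.
    rewrite in_setI in_set !in_setD1 [b \in part l a]in_set.
    case: (boolP (b != a)) => //= ba; case: eqP => //= lab.
    rewrite halvings_split_off 1?eq_sym //.
    by move: hB; rewrite in_setI => /andP[-> ->]; rewrite andbT.
  rewrite big1 // => b; rewrite in_setD1 [b \in part l a]in_set => /andP[ba /eqP lab].
  rewrite in_setI halvings_split_off 1?eq_sym // andbAC.
  by move: hB; rewrite in_setI => ->.
rewrite -mul2n big_distrr /= mulnC -sum_nat_const; apply: eq_bigr => B.
rewrite in_setI => /andP[/halvingsP/(_ a) h _]; rewrite mul2n -h.
have ha := cardsID B (part l a); rewrite setIC in ha.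
have [aB|aB] := boolP (a \in B).
  suff -> : [set b in part l a :\ a | true (+) (b \in B)] = part l a :\: B by lia.
  apply/setP=> b; rewrite !inE andbC /=.
  by case: (boolP (b \in B)) => //= bB; case: eqP bB => // ->; rewrite aB.
suff -> : [set b in part l a :\ a | false (+) (b \in B)] = B :&: part l a by [].
apply/setP=> b; rewrite !inE /= andbC.
by case: (boolP (b \in B)) => //= bB; case: eqP bB => // ->; rewrite (negbTE aB).
Qed.

Lemma mem_part l e : e \in part l e. Proof. by rewrite inE. Qed.

(** Summing the hypothesis over the partners [b] of [a] multiplies both sides of the conclusion by
    the same factor, by [sum_halvings_split_off]. *)
Lemma halvings_correlation_step l r a :
  (forall b, b \in part l a :\ a ->
     #|halvings (split_off l a b)| * #|halvings r|
       <= #|halvings (split_off l a b) :&: halvings r| * 2 ^ #|E|) ->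
  #|halvings l| * #|halvings r| <= #|halvings l :&: halvings r| * 2 ^ #|E|.
Proof.
move=> h; have f0 : 0 < #|part l a| by apply/card_gt0P; exists a; apply: mem_part.
rewrite -(leq_pmul2l f0) !mulnA -sum_halvings_split_off.
have := sum_halvings_split_off l a setT; rewrite setIT => <-.
rewrite -!mul2n -!mulnA leq_pmul2l // !big_distrl /=.
by apply: leq_sum => b /h; rewrite setIT.
Qed.

Lemma pairing_involution l : (forall e, #|part l e| = 2) -> exists s : E -> E,
  [/\ involutive s, forall e, s e != e & forall e, part l e = [set e; s e]].
Proof.
move=> l2.
have ex e : exists f, (part l e == [set e; f]) && (f != e).
  have := l2 e; rewrite (cardsD1 e) mem_part => -[/eqP/cards1P[f fE]].
  exists f; have : f \in part l e :\ e by rewrite fE set11.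
  by rewrite in_setD1 => /andP[-> fp]; rewrite andbT -fE setD1K ?mem_part.
have [s sP] := fin_all_exists ex; exists s.
have sN e : s e != e by case/andP: (sP e).
have sE e : part l e = [set e; s e] by case/andP: (sP e) => /eqP.
split=> // e; have : part l (s e) = part l e.
  have : s e \in part l e by rewrite sE set22.
  by rewrite inE => /eqP h; apply/setP=> x; rewrite !inE h.
rewrite !sE => /setP/(_ (s (s e))); rewrite !inE eqxx orbT => /esym/orP[/eqP//|].
by rewrite (negbTE (sN (s e))).
Qed.

(** With [R] containing one element of each pair, a halving is determined by its trace on [R], and
    equally by its trace off [R]. Gluing two such traces encodes two halvings in one subset of
    [E]. *)
Lemma card_halvings_pairs l : (forall e, #|part l e| = 2) -> #|halvings l| ^ 2 <= 2 ^ #|E|.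
Proof.
move=> /pairing_involution[s [ssE sN sE]].
have halfE B e : B \in halvings l -> (s e \in B) = (e \notin B).
  move=> /halvingsP/(_ e); rewrite sE card_setI2 1?eq_sym // cards2 eq_sym sN.
  by case: (e \in B); case: (s e \in B).
pose rk (e : E) := enum_rank e.
pose R := [set e | rk e < rk (s e)].
have rkN e : rk e <> rk (s e) :> nat.
  by move/val_inj/enum_rank_inj => h; have := sN e; rewrite -h eqxx.
rewrite -mulnn -cardsX -[#|E|]cardsT -card_powerset powersetT cardsT.
pose phi (BB : {set E} * {set E}) := (BB.1 :&: R) :|: (BB.2 :\: R).
rewrite -(card_in_imset (f := phi)); first by apply: max_card.
case=> [B1 B2] [C1 C2]; rewrite !in_setX /= => /andP[B1h B2h] /andP[C1h C2h] /setP eq.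
have eq1 e : e \in R -> (e \in B1) = (e \in C1).
  by move=> eR; have := eq e; rewrite /phi /= !in_setU !in_setI !in_setD eR /= !andbT !orbF.
have eq2 e : e \notin R -> (e \in B2) = (e \in C2).
  move=> eR; have := eq e.
  by rewrite /phi /= !in_setU !in_setI !in_setD eR (negbTE eR) /= !andbF.
have RN e : (s e \in R) = (e \notin R) by rewrite !in_set ssE; have := rkN e; lia.
congr pair; apply/setP=> e; have [eR|eR] := boolP (e \in R).
- exact: eq1.
- by rewrite -[e]ssE (halfE B1 (s e)) // (halfE C1 (s e)) // eq1 ?RN.
- by rewrite -[e]ssE (halfE B2 (s e)) // (halfE C2 (s e)) // eq2 ?RN ?eR.
- exact: eq2.
Qed.

(** The left side is at most [2 ^ #|E|], and one common halving exists by the common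
    two-colouring. *)
Lemma halvings_correlation_pairs l r :
  (forall e, #|part l e| = 2) -> (forall e, #|part r e| = 2) ->
  #|halvings l| * #|halvings r| <= #|halvings l :&: halvings r| * 2 ^ #|E|.
Proof.
move=> l2 r2; apply: (@leq_trans (2 ^ #|E|)).
  rewrite -leq_sqr expnMn -mulnn.
  by apply: leq_mul; apply: card_halvings_pairs.
rewrite leq_pmull //; apply/card_gt0P.
have [s [sK sN sE]] := pairing_involution l2; have [t [tK tN tE]] := pairing_involution r2.
have [B BP] := involutions_common_coloring sK tK sN tN.
exists B; rewrite in_setI; apply/andP; split; apply/halvingsP => e.
  rewrite sE card_setI2 1?eq_sym // (BP e).1 cards2 eq_sym sN.
  by case: (e \in B).
rewrite tE card_setI2 1?eq_sym // (BP e).2 cards2 eq_sym tN.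
by case: (e \in B).
Qed.

(** Induction measure for splitting off pairs until all blocks have two elements. *)
Definition excess l := #|[set e | 2 < #|part l e|]|.

Lemma even_split_off l a b : b \in part l a :\ a ->
  (forall e, ~~ odd #|part l e|) -> forall e, ~~ odd #|part (split_off l a b) e|.
Proof.
rewrite in_setD1 => /andP[ba bl] ev e.
have [eP|eP] := boolP (e \in [set a; b]).
  by rewrite part_split_off_in // cards2 eq_sym ba.
rewrite part_split_off_out // cardsD.
have [le|le] := eqVneq (l e) (l a).
  rewrite card_setI2 1?eq_sym //; move: bl; rewrite !inE -le => /eqP <-.
  rewrite !eqxx; have := ev e; have := oddB; lia.
rewrite (_ : _ :&: _ = set0) ?cards0 ?subn0 //; apply/setP=> x; rewrite !inE.
apply/negbTE/negP => /andP[/eqP h /orP[]/eqP xE]; move: le; rewrite -h xE ?eqxx //.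
by move: bl; rewrite inE => ->.
Qed.

Lemma excess_split_off l a b : b \in part l a :\ a -> 2 < #|part l a| ->
  excess (split_off l a b) < excess l.
Proof.
rewrite in_setD1 => /andP[ba bl] a2; apply: proper_card; apply/properP; split.
  apply/subsetP=> e; rewrite !in_set.
  have [eP|eP] := boolP (e \in [set a; b]).
    by rewrite part_split_off_in // cards2; case: (_ != _).
  rewrite part_split_off_out // => /leq_trans; apply; apply: subset_leq_card.
  exact: subsetDl.
exists a; rewrite in_set // part_split_off_in ?set21 // cards2; by case: (_ != _).
Qed.

(* For a uniformly random subset of [E], the events "splits every part of [l]
   evenly" and "splits every part of [r] evenly" are positively correlated. *)
Theorem halvings_correlation l r :
  (forall e, ~~ odd #|part l e|) -> (forall e, ~~ odd #|part r e|) ->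
  #|halvings l| * #|halvings r| <= #|halvings l :&: halvings r| * 2 ^ #|E|.
Proof.
have [m] := ubnP (excess l + excess r); elim: m l r => // m IH l r hm le re.
have case2 k : (forall e, ~~ odd #|part k e|) ->
    (exists a, 2 < #|part k a|) \/ (forall e, #|part k e| = 2).
  move=> ke; have [/existsP[a ha]|/existsPn h] := boolP [exists a, 2 < #|part k a|].
    by left; exists a.
  right=> e; have := h e; have := ke e.
  have : 0 < #|part k e| by apply/card_gt0P; exists e; apply: mem_part.
  by case: #|part k e| => [|[|[|n]]].
case: (case2 l le) => [[a a2]|l2].
  apply: (@halvings_correlation_step l r a) => b hb.
  apply: IH => //; last exact: even_split_off.
  have := excess_split_off hb a2; lia.
case: (case2 r re) => [[a a2]|r2]; last exact: halvings_correlation_pairs.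
rewrite mulnC setIC; apply: (@halvings_correlation_step r l a) => b hb.
apply: IH => //; last exact: even_split_off.
have := excess_split_off hb a2; lia.
Qed.

End Halvings.

Lemma card_family_const (V T : finType) (F : V -> {set T}) c :
  (forall x, #|F x| = c) -> #|family (fun x => mem (F x))| = c ^ #|V|.
Proof.
move=> Fc; rewrite card_family foldrE big_image /= (eq_bigr (fun=> c)) => [|x _].
  exact: prod_nat_const.
exact: Fc.
Qed.

(** An [h]-subset can be chosen independently in every fibre of [l]. *)
Lemma leq_card_halvings (E V : finType) (l : E -> V) h :
  (forall x, #|[set e | l e == x]| = h.*2) ->
  'C(h.*2, h) ^ #|V| <= #|halvings (fun e => enum_rank (l e) : nat)|.
Proof.
move=> lh.
pose F x := [set C : {set E} | C \subset [set e | l e == x] & #|C| == h].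
rewrite -(@card_family_const V _ F); last by move=> x; rewrite cards_draws lh.
pose phi (f : {ffun V -> {set E}}) := [set e | e \in f (l e)].
have phiE f x : f \in family (fun x => mem (F x)) ->
    phi f :&: [set e | l e == x] = f x.
  move=> /familyP/(_ x); rewrite inE => /andP[/subsetP fx _].
  apply/setP=> e; rewrite !inE; have [<-|le] := eqVneq (l e) x; first by rewrite andbT.
  by rewrite andbF; apply/esym/negbTE; apply: contra le => /fx; rewrite inE.
rewrite -(@card_in_imset _ _ phi); last first.
  move=> f g hf hg fg; apply/ffunP => x.
  by rewrite -(phiE _ _ hf) -(phiE _ _ hg) fg.
apply: subset_leq_card; apply/subsetP=> _ /imsetP[f hf ->].
apply/halvingsP => e.
have -> : part (fun e : E => enum_rank (l e) : nat) e = [set e' | l e' == l e].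
  by apply/setP=> e'; rewrite !inE (inj_eq val_inj) (inj_eq enum_rank_inj).
rewrite phiE // lh; move/familyP: hf => /(_ (l e)); rewrite inE => /andP[_ /eqP ->].
by [].
Qed.

(** * Counting 1-factorisations of regular bipartite graphs *)

Section Factorizations.
Variables (E V : finType) (l r : E -> V).
Implicit Types A B : {set E}.

(** Each [e : E] is an edge from [l e] on one side to [r e] on the other, both sides being copies of
    [V]; parallel edges are possible. *)
Definition regular h (A : {set E}) :=
  [forall x, (#|[set e in A | l e == x]| == h) && (#|[set e in A | r e == x]| == h)].

Lemma regularP h A : reflect
  (forall x, #|[set e in A | l e == x]| = h /\ #|[set e in A | r e == x]| = h) (regular h A).
Proof.
apply: (iffP forallP) => hA x; first by have /andP[/eqP -> /eqP ->] := hA x.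
by have [-> ->] := hA x; rewrite eqxx.
Qed.

Lemma card_regular h A : regular h A -> #|A| = (h * #|V|)%N.
Proof.
move=> /regularP hA; rewrite -sum1_card (partition_big l predT) //=.
rewrite (eq_bigr (fun=> h)) ?sum_nat_const 1?mulnC // => x _.
by rewrite -(hA x).1 -sum1_card; apply: eq_bigl => e; rewrite inE.
Qed.

Lemma regular_complement h A B : B \subset A -> regular h.*2 A -> regular h B ->
  regular h (A :\: B).
Proof.
move=> BA /regularP hA /regularP hB; apply/regularP => x.
suff c (k : E -> V) : #|[set e in A | k e == x]| =
    #|[set e in B | k e == x]| + #|[set e in A :\: B | k e == x]|.
  have := c l; have := c r; rewrite (hA x).1 (hA x).2 (hB x).1 (hB x).2; lia.
rewrite -(cardsID B [set e in A | k e == x]); congr addn; apply: eq_card => e.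
  rewrite !inE; have [eB|_] := boolP (e \in B); last by rewrite andbF.
  by rewrite (subsetP BA) //= andbT.
by rewrite !inE andbA.
Qed.

Definition regular_halves h A := [set B in powerset A | regular h B].

(** [halvings_correlation] for the partitions of [A] by left and by right ends: each is halved by at
    least ['C(h.*2, h) ^ #|V|] of the [2 ^ #|A|] subsets. *)
Lemma card_regular_halves h A : 0 < h -> regular h.*2 A ->
  'C(h.*2, h) ^ (2 * #|V|) <= #|regular_halves h A| * 2 ^ (h.*2 * #|V|).
Proof.
(* Halvings are subsets of a whole finite type, so [A] is made into one. *)
move=> h0 rA; pose S := {e | e \in A}.
pose lab (k : E -> V) (e : S) : nat := enum_rank (k (val e)).
have cS (k : E -> V) x : #|[set e : S | k (val e) == x]| = #|[set e in A | k e == x]|.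
  rewrite -(card_imset _ (val_inj : injective (val : S -> E))); apply: eq_card => e.
  apply/imsetP/idP => [[f + ->]|]; rewrite !inE; first by rewrite (valP f).
  by case/andP=> eA ke; exists (Sub e eA); rewrite ?inE SubK.
have lh x : #|[set e : S | l (val e) == x]| = h.*2.
  by rewrite cS; have /regularP/(_ x)[] := rA.
have rh x : #|[set e : S | r (val e) == x]| = h.*2.
  by rewrite cS; have /regularP/(_ x)[] := rA.
have partE (k : E -> V) e : part (lab k) e = [set e' : S | k (val e') == k (val e)].
  by apply/setP=> e'; rewrite !inE (inj_eq val_inj) (inj_eq enum_rank_inj).
have := leq_card_halvings lh; have := leq_card_halvings rh; rewrite -/(lab l) -/(lab r).
have := @halvings_correlation _ (lab l) (lab r).
rewrite card_sig (eq_card (B := mem A)) // (card_regular rA).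
have ev (k : E -> V) : (forall x, #|[set e : S | k (val e) == x]| = h.*2) ->
    forall e, ~~ odd #|part (lab k) e|.
  by move=> kh e; rewrite partE kh odd_double.
move=> /(_ (ev _ lh) (ev _ rh)) H Hr Hl.
rewrite mulSn mul1n expnD; apply: (leq_trans (leq_mul Hl Hr)); apply: (leq_trans H).
rewrite leq_mul2r; apply/orP; right.
rewrite -(card_imset _ (@imset_inj _ _ (val : S -> E) val_inj)).
apply: subset_leq_card; apply/subsetP => _ /imsetP[B + ->].
rewrite in_setI => /andP[/halvingsP Bl /halvingsP Br]; rewrite inE powersetE.
apply/andP; split; first by apply/subsetP => _ /imsetP[e _ ->]; apply: valP.
have key (k : E -> V) : (forall x, #|[set e : S | k (val e) == x]| = h.*2) ->
    (forall e, #|B :&: part (lab k) e|.*2 = #|part (lab k) e|) ->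
    forall x, #|[set e in val @: B | k e == x]| = h.
  move=> kh Bk x.
  have /card_gt0P[e] : 0 < #|[set e : S | k (val e) == x]| by rewrite kh double_gt0.
  rewrite inE => /eqP ke; have := Bk e; rewrite partE ke kh => /double_inj <-.
  rewrite -(card_imset _ (val_inj : injective (val : S -> E))); apply: eq_card => f.
  apply/idP/imsetP => [|[f' + ->]]; rewrite !inE.
    by case/andP=> /imsetP[f' f'B ->] kf; exists f'; rewrite // !inE f'B.
  by case/andP=> f'B ->; rewrite andbT; apply: imset_f.
by apply/regularP => x; split; apply: key.
Qed.

(* [factorizations m A] counts the ordered decompositions of a [2 ^ m]-regular
   set [A] into perfect matchings. *)
Fixpoint factorizations m (A : {set E}) : nat :=
  if m is m'.+1 then
    \sum_(B in regular_halves (2 ^ m') A) factorizations m' B * factorizations m' (A :\: B)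
  else regular 1 A.

(** The bound is multiplicative under halving: [(2 h)!] is ['C(2 h, h)] times the square of [h!],
    and [(2 h) ^ (2 h n)] is [2 ^ (2 h n)] times the square of [h ^ (h n)]. *)
Lemma factorizations_lower m A : regular (2 ^ m) A ->
  (2 ^ m)`! ^ (2 * #|V|) <= factorizations m A * (2 ^ m) ^ (2 ^ m * #|V|).
Proof.
elim: m A => [|m IH] A rA /=; first by rewrite rA !exp1n.
set h := 2 ^ m in IH *; have h0 : 0 < h by rewrite expn_gt0.
have hE : 2 ^ m.+1 = h.*2 by rewrite expnS mul2n.
rewrite hE in rA *.
set L := \sum_(B in _) _.
set c := h`! ^ (2 * #|V|) in IH.
set d := h ^ (h * #|V|) in IH.
have sumL : #|regular_halves h A| * (c * c) <= L * (d * d).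
  rewrite big_distrl /= -sum_nat_const; apply: leq_sum => B.
  rewrite inE powersetE => /andP[BA rB].
  by rewrite mulnACA leq_mul ?IH ?regular_complement.
have -> : h.*2`! ^ (2 * #|V|) = 'C(h.*2, h) ^ (2 * #|V|) * (c * c).
  rewrite -!expnMn; congr (_ ^ _); have := @bin_fact h.*2 h.
  by rewrite -addnn leq_addr addnK => /(_ isT).
have -> : h.*2 ^ (h.*2 * #|V|) = d * d * 2 ^ (h.*2 * #|V|).
  by rewrite -[X in X ^ _]mul2n expnMn mulnC -!expnD -mulnDl addnn.
apply: (leq_trans (leq_mul (card_regular_halves h0 rA) (leqnn _))).
by rewrite mulnAC [leqRHS]mulnA leq_mul2r sumL orbT.
Qed.

(** The pieces of a decomposition determine the set decomposed, so even the sum over all [A] counts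
    distinct tuples. In the induction, [phi] is injective because [A] is the union of [B] and
    [A :\: B]. *)
Lemma factorizations_upper m :
  \sum_(A : {set E}) factorizations m A <= #|[set A | regular 1 A]| ^ (2 ^ m).
Proof.
elim: m => [|m IH]; first by rewrite expn1 -sum1_card [leqRHS]big_mkcond leq_sum // => A _ /=; rewrite inE; case: regular.
rewrite expnS mulSn mul1n expnD; apply: leq_trans (leq_mul IH IH).
rewrite big_distrlr pair_big_dep /= pair_big /=.
pose phi (AB : {set E} * {set E}) := (AB.2, AB.1 :\: AB.2).
rewrite [leqRHS](bigID (mem (phi @: [set AB | AB.2 \in regular_halves (2 ^ m) AB.1]))) /=.
rewrite big_imset /=; last first.
  move=> [A B] [A' B']; rewrite !inE /= => /andP[/setIidPr BA _] /andP[/setIidPr BA' _].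
  by case=> BB; rewrite -BB in BA' * => AA; rewrite -(setID A B) -(setID A' B) BA BA' AA.
apply: leq_trans (leq_addr _ _); rewrite leq_eqVlt; apply/orP; left.
apply/eqP; apply: eq_big => [AB|AB _ //]. by rewrite [RHS]inE.
Qed.

End Factorizations.

(** From [d ^ d * d! <= (2 d)! = 'C(2 d, d) * d! * d!] and ['C(2 d, d) <= 2 ^ (2 d)]. *)
Lemma expn_self_leq_fact d : d ^ d <= 4 ^ d * d`!.
Proof.
have lb m : d ^ m * d`! <= (d + m)`!.
  elim: m => [|m IH]; first by rewrite mul1n addn0.
  by rewrite addnS factS expnS -mulnA leq_mul // leqW // leq_addr.
have := @bin_fact (d + d) d (leq_addr _ _); rewrite addnK => bf.
have := lb d; rewrite -bf mulnA leq_pmul2r ?fact_gt0 // => /leq_trans; apply.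
rewrite leq_mul2r; apply/orP; right.
have := expnDn 1 1 (d + d); rewrite (expnD 2) -expnMn => ->.
by rewrite (bigD1 (inord d)) //= inordK ?ltnS ?leq_addr // !exp1n !muln1 leq_addr.
Qed.

Lemma expn_leq_of_fact d P n : 0 < d ->
  d`! ^ (2 * n) <= P ^ d * d ^ (d * n) -> d ^ n <= P * 16 ^ n.
Proof.
move=> d0 H; rewrite -(@leq_exp2r _ _ d) // expnMn -!expnM.
rewrite -(@leq_pmul2r (d ^ (d * n))) ?expn_gt0 ?d0 //.
have -> : d ^ (n * d) * d ^ (d * n) = (d ^ d) ^ (2 * n).
  by rewrite -expnD -expnM; congr (_ ^ _); lia.
have -> : P ^ d * 16 ^ (n * d) * d ^ (d * n) = P ^ d * d ^ (d * n) * (4 ^ d) ^ (2 * n).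
  by rewrite mulnAC (_ : 16 = 4 ^ 2) // -!expnM; congr (_ * _ ^ _); lia.
apply: leq_trans (leq_mul H (leqnn _)).
rewrite mulnC -expnMn; have [->|n0] := posnP n; first by [].
by rewrite leq_exp2r ?muln_gt0 ?n0 // mulnC expn_self_leq_fact.
Qed.

(* Every 1-factorisation is a [d]-tuple of perfect matchings, so the number of
   perfect matchings is at least the [d]-th root of the number of 1-factorisations. *)
Lemma card_perfect_matchings (V : finType) m (g : 'I_(2 ^ m) -> {perm V}) :
  (forall x, injective (g^~ x)) ->
  (2 ^ m) ^ #|V| <= #|[set M : {perm V} | [forall x, exists i, M x == g i x]]| * 16 ^ #|V|.
Proof.
set d := 2 ^ m in g * => g_inj; set PM := [set M | _].
pose E := (V * 'I_d)%type; pose l (e : E) := e.1; pose r (e : E) := g e.2 e.1.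
have rT : regular l r d setT.
  apply/regularP => x; split.
    rewrite (eq_card (B := mem (setX [set x] [set: 'I_d]))); last first.
      by move=> [y i]; rewrite !inE /l /= andbT.
    by rewrite cardsX cards1 cardsT card_ord mul1n.
  rewrite -[RHS]card_ord -cardsT -(card_imset _ (f := fun i : 'I_d => ((g i)^-1%g x, i))); last by move=> i j [].
  apply: eq_card => -[y i]; rewrite !inE /r /=; apply/eqP/imsetP => [<-|[j _ [-> ->]]].
    by exists i; rewrite // permK.
  by rewrite permKV.
set P := #|[set A : {set E} | regular l r 1 A]|.
have PPM : P <= #|PM|.
  (* A 1-regular edge set is the graph of a permutation, and is recovered from it because distinct
     colours at [x] lead to distinct neighbours. The identity is a default for other sets. *)
  have ex A : exists M : {perm V}, regular l r 1 A -> A = [set e | M e.1 == r e] /\ M \in PM.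
    have [rA|_] := boolP (regular l r 1 A); last by exists 1%g.
    have /regularP hA := rA.
    have [f fP] : exists f : V -> 'I_d, forall x, [set e in A | l e == x] = [set (x, f x)].
      apply: (@fin_all_exists _ (fun=> 'I_d) (fun x i => [set e in A | l e == x] = [set (x, i)])) => x.
      have /eqP/cards1P[[y i] yi] := (hA x).1; exists i; rewrite yi; congr [set (_, _)].
      have : (y, i) \in [set e in A | l e == x] by rewrite yi set11.
      by rewrite !inE => /andP[_ /eqP].
    have AE x i : ((x, i) \in A) = (i == f x).
      have /setP/(_ (x, i)) := fP x; rewrite !inE /l /= eqxx andbT => ->.
      by rewrite xpair_eqE eqxx.
    have M_inj : injective (fun x => g (f x) x).
      move=> x y /= xy; have /eqP/cards1P[e eE] := (hA (g (f x) x)).2.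
      have := set11 e; rewrite -eE => _.
      have : (x, f x) \in [set e] by rewrite -eE !inE AE /r /= !eqxx.
      have : (y, f y) \in [set e] by rewrite -eE !inE AE /r /= xy !eqxx.
      by rewrite !inE => /eqP <- /eqP[].
    exists (perm M_inj) => _; split; last first.
      by rewrite inE; apply/forallP => x; apply/existsP; exists (f x); rewrite permE.
    by apply/setP => -[x i]; rewrite inE AE permE /r /= (inj_eq (g_inj x)) eq_sym.
  have [F FP] := fin_all_exists ex.
  rewrite /P -(@card_in_imset _ _ F); last first.
    by move=> A B; rewrite !inE => /FP[hA _] /FP[hB _] AB; rewrite hA AB -hB.
  by apply: subset_leq_card; apply/subsetP => _ /imsetP[A + ->]; rewrite inE => /FP[].
have d0 : 0 < d by rewrite expn_gt0.
apply: leq_trans (leq_mul PPM (leqnn _)).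
have := factorizations_lower rT; rewrite -/d => lo.
have up : factorizations l r m setT <= P ^ d.
  apply: leq_trans (factorizations_upper _ _ _).
  by rewrite (bigD1 setT) //= leq_addr.
have {lo up} : d`! ^ (2 * #|V|) <= P ^ d * d ^ (d * #|V|).
  by apply: leq_trans lo _; rewrite leq_mul2r up orbT.
exact: expn_leq_of_fact.
Qed.

(** * Bipartite graphs without short cycles *)

(* In the bipartite graph joining [x] to every [g c x], all closed walks of length
   [2 k] backtrack at some step before the last. *)
Definition alternating_free k (C V : Type) (g : C -> V -> V) : Prop :=
  forall (y : nat -> V) (c : nat -> C),
    (forall a, (a < k)%N -> y (2 * a).+1 = g (c (2 * a)%N) (y (2 * a)%N)) ->
    (forall a, (a < k)%N -> y (2 * a).+1 = g (c (2 * a).+1) (y (2 * a).+2)) ->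
    (forall b, (b.+1 < 2 * k)%N -> c b <> c b.+1) ->
    y (2 * k)%N <> y 0%N.

Module Quaternion.
Import Order.TTheory GRing.Theory Num.Theory.
Local Open Scope ring_scope.

Notation quat R := (R * R * R * R)%type.

(** * Quaternions over a commutative ring *)

Section Quaternions.
Variable R : comNzRingType.
Implicit Types x y z w : quat R.

Definition qmul x y : quat R :=
  let: (a, b, c, d) := x in let: (e, f, g, h) := y in
  (a * e - b * f - c * g - d * h, a * f + b * e + c * h - d * g,
   a * g - b * h + c * e + d * f, a * h + b * g - c * f + d * e).
Definition qconj x : quat R := let: (a, b, c, d) := x in (a, - b, - c, - d).
Definition qnorm x : R := let: (a, b, c, d) := x in a ^+ 2 + b ^+ 2 + c ^+ 2 + d ^+ 2.
Definition qre x : R := x.1.1.1.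
Definition qscal (t : R) : quat R := (t, 0, 0, 0).
Definition qscale (t : R) x : quat R :=
  let: (a, b, c, d) := x in (t * a, t * b, t * c, t * d).

Ltac qring := rewrite /qmul /qconj /qnorm /qscal /qscale /qre /=; try congr (_, _, _, _); ring.

Lemma qmulA x y z : qmul x (qmul y z) = qmul (qmul x y) z.
Proof. by case: x y z => [[[? ?] ?] ?] [[[? ?] ?] ?] [[[? ?] ?] ?]; qring. Qed.

Lemma qmul1 x : qmul (qscal 1) x = x.
Proof. by case: x => [[[? ?] ?] ?]; qring. Qed.

Lemma qmulq1 x : qmul x (qscal 1) = x.
Proof. by case: x => [[[? ?] ?] ?]; qring. Qed.

Lemma qmul_scal t x : qmul (qscal t) x = qscale t x.
Proof. by case: x => [[[? ?] ?] ?]; qring. Qed.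

Lemma qmul_scaler t x y : qmul x (qscale t y) = qscale t (qmul x y).
Proof. by case: x y => [[[? ?] ?] ?] [[[? ?] ?] ?]; qring. Qed.

Lemma qmul_scalel t x y : qmul (qscale t x) y = qscale t (qmul x y).
Proof. by case: x y => [[[? ?] ?] ?] [[[? ?] ?] ?]; qring. Qed.

Lemma qscaleA s t x : qscale s (qscale t x) = qscale (s * t) x.
Proof. by case: x => [[[? ?] ?] ?]; qring. Qed.

Lemma qscale1 x : qscale 1 x = x.
Proof. by case: x => [[[? ?] ?] ?]; qring. Qed.

Lemma qscaleq1 t : qscale t (qscal 1) = qscal t.
Proof. by qring. Qed.

Lemma qmul0 x : qmul 0 x = 0.
Proof. by case: x => [[[? ?] ?] ?]; qring. Qed.

Lemma qscale0 x : qscale 0 x = 0.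
Proof. by case: x => [[[? ?] ?] ?]; rewrite /qscale !mul0r. Qed.

Lemma qconjM x y : qconj (qmul x y) = qmul (qconj y) (qconj x).
Proof. by case: x y => [[[? ?] ?] ?] [[[? ?] ?] ?]; qring. Qed.

Lemma qconjK : involutive qconj.
Proof. by case=> [[[? ?] ?] ?]; rewrite /qconj !opprK. Qed.

Lemma qmul_conjr x : qmul x (qconj x) = qscal (qnorm x).
Proof. by case: x => [[[? ?] ?] ?]; qring. Qed.

Lemma qmul_conjl x : qmul (qconj x) x = qscal (qnorm x).
Proof. by case: x => [[[? ?] ?] ?]; qring. Qed.

Lemma qnormM x y : qnorm (qmul x y) = qnorm x * qnorm y.
Proof. by case: x y => [[[? ?] ?] ?] [[[? ?] ?] ?]; qring. Qed.

Lemma qnorm_conj x : qnorm (qconj x) = qnorm x.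
Proof. by case: x => [[[? ?] ?] ?]; qring. Qed.

Lemma qnorm_scal t : qnorm (qscal t) = t ^+ 2.
Proof. by qring. Qed.

Lemma qnorm_scale t x : qnorm (qscale t x) = t ^+ 2 * qnorm x.
Proof. by case: x => [[[? ?] ?] ?]; qring. Qed.

Lemma qconj0 : qconj 0 = 0 :> quat R.
Proof. by rewrite /qconj /= !oppr0. Qed.

Lemma qre_mulC x y : qre (qmul x y) = qre (qmul y x).
Proof. by case: x y => [[[? ?] ?] ?] [[[? ?] ?] ?]; qring. Qed.

(** [y u] is twice its real part minus its conjugate, and that conjugate times [y] contains the
    factor [qnorm y]. *)
Lemma qmul_sandwich y u : qnorm y = 0 ->
  qmul (qmul y u) y = qscale (2%:R * qre (qmul y u)) y.
Proof.
case: y u => [[[a b] c] d] [[[e f] g] h]; rewrite /qnorm => N.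
have aE : a ^+ 2 = - (b ^+ 2 + c ^+ 2 + d ^+ 2).
  by apply/eqP; rewrite -addr_eq0 !addrA N.
rewrite /qmul /qscale /qre /=; congr (_, _, _, _); ring: aE.
Qed.

(** Averaging [e y (qconj e)] over the four basis units leaves the real part of [y]. *)
Lemma qmul_average x y :
  let e1 := qscal 1 in let e2 : quat R := (0, 1, 0, 0) in
  let e3 : quat R := (0, 0, 1, 0) in let e4 : quat R := (0, 0, 0, 1) in
  let t e := qmul (qmul x e) (qmul y (qconj e)) in
  t e1 + t e2 + t e3 + t e4 = qscale (4%:R * qre y) x.
Proof.
by case: x y => [[[a b] c] d] [[[e f] g] h]; rewrite /qmul /qscale /qconj /qscal /qre /=;
  congr (_, _, _, _); rewrite /=; ring.
Qed.

End Quaternions.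

(** * Zero divisors over a field of characteristic other than two *)

Section QuaternionsField.
Variable F : fieldType.
Hypothesis two_neq0 : 2%:R != 0 :> F.
Implicit Types x y z w : quat F.

Lemma qscale_eq0 t x : qscale t x = 0 -> t = 0 \/ x = 0.
Proof.
case: x => [[[a b] c] d] [/eqP ha /eqP hb /eqP hc /eqP hd].
have [->|t0] := eqVneq t 0; [by left|right; move: ha hb hc hd].
by rewrite !mulf_eq0 (negbTE t0) /= => /eqP -> /eqP -> /eqP -> /eqP ->.
Qed.

(** If [x] is nonzero, averaging shows that the real part of [y z] vanishes for every [z]; the four
    basis units as [z] kill the coordinates of [y]. *)
Lemma qmul_prime x y : (forall w, qmul (qmul x w) y = 0) -> x = 0 \/ y = 0.
Proof.
move=> xy0; have [->|x0] := eqVneq x 0; [by left|right].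
have re0 z : qre (qmul y z) = 0.
  have := qmul_average x (qmul y z) => /=.
  have tE e : qmul (qmul x e) (qmul (qmul y z) (qconj e)) = 0.
    by rewrite -(qmulA y z) (qmulA _ y) xy0 qmul0.
  rewrite !tE !addr0 => /esym/qscale_eq0[|/eqP]; last by rewrite (negbTE x0).
  move/eqP; rewrite mulf_eq0 (_ : 4%:R = 2%:R * 2%:R) ?mulf_eq0; last by rewrite -natrM.
  by rewrite (negbTE two_neq0) /= => /eqP.
have := re0 (qscal 1); have := re0 (0, 1, 0, 0); have := re0 (0, 0, 1, 0).
have := re0 (0, 0, 0, 1); case: y {xy0 re0} => [[[a b] c] d].
rewrite /qmul /qre /qscal /= !mulr0 !mulr1 !subr0 !sub0r.
by move=> /eqP + /eqP + /eqP + ->; rewrite !oppr_eq0 => /eqP -> /eqP -> /eqP ->.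
Qed.

(* Nonzero isotropic quaternions are the rank one elements of the split
   algebra, whence the cancellation rule below. *)
Lemma qmul3_eq0 x y z : qnorm y = 0 ->
  qmul (qmul x y) z = 0 -> qmul x y = 0 \/ qmul y z = 0.
Proof.
move=> Ny xyz0; suff /qmul_prime[] : forall w, qmul (qmul (qmul y z) w) (qmul x y) = 0.
- by right.
- by left.
move=> w; rewrite !qmulA.
(* By [qmul_sandwich] this is [y] scaled by twice the real part of [y z w x], which by cyclic
   invariance is the real part of [x y z w = 0]. *)
rewrite (_ : qmul (qmul (qmul (qmul y z) w) x) y = qmul (qmul y (qmul (qmul z w) x)) y).
  rewrite qmul_sandwich // !qmulA qre_mulC !qmulA xyz0 qmul0 /qre /= mulr0.
  exact: qscale0.
by rewrite !qmulA.
Qed.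

End QuaternionsField.

Section IntegerQuaternions.
Variable R : comNzRingType.

Definition qmapz (x : quat int) : quat R :=
  let: (a, b, c, d) := x in (a%:~R, b%:~R, c%:~R, d%:~R).

Lemma qmapzM x y : qmapz (qmul x y) = qmul (qmapz x) (qmapz y).
Proof.
by case: x y => [[[? ?] ?] ?] [[[? ?] ?] ?]; rewrite /qmapz /qmul !(rmorphB, rmorphD, rmorphM).
Qed.

Lemma qmapz_conj x : qmapz (qconj x) = qconj (qmapz x).
Proof. by case: x => [[[? ?] ?] ?]; rewrite /qmapz /qconj !rmorphN. Qed.

Lemma qnorm_mapz x : qnorm (qmapz x) = (qnorm x)%:~R.
Proof. by case: x => [[[? ?] ?] ?]; rewrite /qmapz /qnorm !(rmorphD, rmorphXn). Qed.

Lemma qmapz_scal t : qmapz (qscal t) = qscal t%:~R. Proof. by []. Qed.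

End IntegerQuaternions.

Lemma qnorm_ge0 (x : quat int) : 0 <= qnorm x.
Proof. by case: x => [[[a b] c] d]; rewrite /qnorm !addr_ge0 ?sqr_ge0. Qed.

Lemma qnorm_eq0 (x : quat int) : qnorm x = 0 -> x = 0.
Proof.
case: x => [[[a b] c] d]; rewrite /qnorm => h.
have [-> -> -> ->] : [/\ a = 0, b = 0, c = 0 & d = 0] by split; nia.
by [].
Qed.

(** * Short integer quaternions that are isotropic modulo a prime *)

Section PrimeField.
Variable p : nat.
Hypotheses (p_pr : prime p) (p_gt5 : (5 < p)%N).

Let pF : p \in [pchar 'F_p]. Proof. exact: pchar_Fp. Qed.

Lemma Fp_two_neq0 : 2%:R != 0 :> 'F_p.
Proof. by rewrite -(dvdn_pcharf pF) gtnNdvd // (ltn_trans _ p_gt5). Qed.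

Lemma Fp_natr_inj i j : (i < p)%N -> (j < p)%N -> i%:R = j%:R :> 'F_p -> i = j.
Proof. by move=> ip jp /(congr1 val); rewrite /= !val_Fp_nat // !modn_small. Qed.

Lemma Fp_natr_eq0 n : (n%:R == 0 :> 'F_p) = (p %| n)%N.
Proof. by rewrite (dvdn_pcharf pF). Qed.

Lemma qmapz_eq0 (x : quat int) : qmapz 'F_p x = 0 -> exists y, x = qscale p%:Z y.
Proof.
case: x => [[[a b] c] d] [/eqP ha /eqP hb /eqP hc /eqP hd]; move: ha hb hc hd.
rewrite -!(dvdz_pcharf pF) => /dvdzP[a' ->] /dvdzP[b' ->] /dvdzP[c' ->] /dvdzP[d' ->].
by exists (a', b', c', d'); rewrite /qscale !(mulrC p%:Z).
Qed.

(** There are [(p + 1) / 2] squares and as many values of [- 1] minus a square, so the two sets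
    meet. *)
Lemma Fp_sqr_sum : exists r s : 'F_p, r ^+ 2 + s ^+ 2 = - 1.
Proof.
pose h := (p.-1./2).+1.
have p_odd : odd p by case: (even_prime p_pr) => // pE; move: p_gt5; rewrite pE.
have hp : (h.*2 = p.+1)%N by rewrite /h; have := odd_double_half p; rewrite p_odd; lia.
pose f (i : 'I_h) : 'F_p := i%:R ^+ 2.
have f_inj : injective f.
  move=> i j /eqP; rewrite -subr_eq0 subr_sqr mulf_eq0 subr_eq0 -natrD Fp_natr_eq0.
  have ih := ltn_ord i; have jh := ltn_ord j.
  case/orP=> [/eqP/Fp_natr_inj h1|dv]; apply/val_inj => /=.
    by apply: h1; lia.
  have : (i + j < p)%N by lia.
  by case: (posnP (i + j)) => [|ij]; [|have := dvdn_leq ij dv]; lia.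
pose g (i : 'I_h) : 'F_p := - 1 - f i.
have g_inj : injective g by move=> i j /addrI/oppr_inj/f_inj.
have /set0Pn[x] : [set f i | i : 'I_h] :&: [set g i | i : 'I_h] != set0.
  apply/eqP => h0; have := cardsUI [set f i | i : 'I_h] [set g i | i : 'I_h].
  rewrite h0 cards0 !card_imset // card_ord addn0 => cU.
  by have := max_card (mem ([set f i | i : 'I_h] :|: [set g i | i : 'I_h])); rewrite cU card_Fp //; lia.
rewrite inE => /andP[/imsetP[i _ ->] /imsetP[j _ ij]].
by exists i%:R, j%:R; move: ij; rewrite /g /f => ->; rewrite subrK.
Qed.

Definition isotropic_slopes : {set 'F_p * 'F_p} := [set z | z.1 ^+ 2 + z.2 ^+ 2 == - 1].

(** One solution is rotated by the rational points of the unit circle, parametrised by all [t] but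
    the at most two roots of [1 + t ^ 2]; [t] is recovered as [y / (x + 1)]. *)
Lemma card_isotropic_slopes : (p - 2 <= #|isotropic_slopes|)%N.
Proof.
have [r [s rs]] := Fp_sqr_sum.
pose T := [set t : 'F_p | 1 + t ^+ 2 == 0].
have cT : (#|T| <= 2)%N.
  have [->|[t0 t0T]] := set_0Vmem T; first by rewrite cards0.
  apply: (@leq_trans #|[set t0; - t0]|); last by rewrite cards2; case: (_ != _).
  apply: subset_leq_card; apply/subsetP => t; move: t0T; rewrite !inE => /eqP h0 /eqP ht.
  by rewrite -eqf_sqr; apply/eqP/(addrI 1); rewrite ht h0.
have cTC := cardsC T; rewrite card_Fp // in cTC.
apply: (@leq_trans #|~: T|); first lia.
pose x (t : 'F_p) := (1 - t ^+ 2) / (1 + t ^+ 2); pose y (t : 'F_p) := 2%:R * t / (1 + t ^+ 2).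
pose f t := (r * x t - s * y t, r * y t + s * x t).
have xy t : t \in ~: T -> x t ^+ 2 + y t ^+ 2 = 1.
  by rewrite !inE => tT; rewrite /x /y; field.
have x1 t : t \in ~: T -> x t + 1 = 2%:R / (1 + t ^+ 2).
  by rewrite !inE => tT; rewrite /x; field.
rewrite -(card_in_imset (f := f)).
  apply: subset_leq_card; apply/subsetP => _ /imsetP[t tT ->]; rewrite inE /=.
  have -> : (r * x t - s * y t) ^+ 2 + (r * y t + s * x t) ^+ 2
      = (r ^+ 2 + s ^+ 2) * (x t ^+ 2 + y t ^+ 2) by ring.
  by rewrite rs xy // mulr1.
move=> t u tT uT ftu.
have e1 : r * x t - s * y t = r * x u - s * y u := congr1 fst ftu.
have e2 : r * y t + s * x t = r * y u + s * x u := congr1 snd ftu.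
have rx v : x v = - (r * (r * x v - s * y v) + s * (r * y v + s * x v)).
  have -> : r * (r * x v - s * y v) + s * (r * y v + s * x v) = (r ^+ 2 + s ^+ 2) * x v by ring.
  by rewrite rs mulN1r opprK.
have ry v : y v = - (r * (r * y v + s * x v) - s * (r * x v - s * y v)).
  have -> : r * (r * y v + s * x v) - s * (r * x v - s * y v) = (r ^+ 2 + s ^+ 2) * y v by ring.
  by rewrite rs mulN1r opprK.
have xE : x t = x u by rewrite rx [RHS]rx e1 e2.
have yE : y t = y u by rewrite ry [RHS]ry e1 e2.
have tE v : v \in ~: T -> v = y v / (x v + 1).
  move=> vT; rewrite x1 // /y; move: vT; rewrite !inE => vT.
  by field; rewrite vT Fp_two_neq0.
by rewrite (tE t) // (tE u) // xE yE.
Qed.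

Definition on_plane (z : 'F_p * 'F_p) (x : quat int) : Prop :=
  let: (a, b, c, d) := qmapz 'F_p x in c = z.1 * a - z.2 * b /\ d = z.2 * a + z.1 * b.

(* Thue's pigeonhole argument, for the lattice of quaternions reducing mod [p]
   into the isotropic plane [{(w, z w)}] of [F_p[i] + F_p[i] j]. *)
Lemma small_quat_on_plane z : z \in isotropic_slopes -> exists x : quat int,
  [/\ on_plane z x, qmapz 'F_p x != 0 &
      exists2 c : nat, (0 < c <= 3)%N & qnorm x = (c * p)%N%:Z].
Proof.
rewrite inE => /eqP zE.
have [m mp pm] : exists2 m, (m ^ 2 < p)%N & (p < m.+1 ^ 2)%N.
  have ex : exists m, (m ^ 2 < p)%N by exists 0%N; rewrite prime_gt0.
  have ub m : (m ^ 2 < p)%N -> (m <= p)%N by nia.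
  case: (ex_maxnP ex ub) => m mp mM; exists m => //.
  rewrite ltnNge; apply/negP => h; have : (m.+1 ^ 2 < p)%N.
    rewrite ltn_neqAle h andbT; apply/eqP => pE.
    have m1 : m.+1 != 1%N by nia.
    have /(prime_nt_dvdP p_pr m1) : (m.+1 %| p)%N by rewrite -pE dvdn_mulr.
    by nia.
  by move/mM; rewrite ltnn.
pose I := 'I_m.+1; pose q (x : I * I * I * I) : quat int :=
  (x.1.1.1%:Z, x.1.1.2%:Z, x.1.2%:Z, x.2%:Z).
pose f (x : I * I * I * I) := let: (a, b, c, d) := qmapz 'F_p (q x) in
   (c - (z.1 * a - z.2 * b), d - (z.2 * a + z.1 * b)).
(* There are [(m + 1) ^ 4 > p ^ 2] points and only [p ^ 2] values of [f]. *)
have /injectivePn[x [y xy fxy]] : ~~ injectiveb f.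
  apply/negP => /injectiveP/leq_card; rewrite !card_prod (card_Fp p_pr) card_ord.
  nia.
pose u := q x - q y.
have uE : u = (x.1.1.1%:Z - y.1.1.1%:Z, x.1.1.2%:Z - y.1.1.2%:Z, x.1.2%:Z - y.1.2%:Z, x.2%:Z - y.2%:Z) by [].
have plane : on_plane z u.
  have h1 := congr1 fst fxy; have h2 := congr1 snd fxy.
  move: h1 h2; rewrite /f /q /qmapz uE /on_plane /qmapz [LHS]/fst [RHS]/fst.
  rewrite [X in _ -> X = _ -> _]/snd [X in _ -> _ = X -> _]/snd !intrB.
  move=> /eqP; rewrite subr_eq => /eqP h1 /eqP; rewrite subr_eq => /eqP h2.
  by rewrite h1 h2; split; ring.
have bnd (i j : I) : `|i%:Z - j%:Z| <= m%:Z by have := ltn_ord i; have := ltn_ord j; lia.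
have u0 : u != 0.
  apply: contra xy => /eqP; rewrite uE => -[/eqP + /eqP + /eqP + /eqP].
  rewrite !subr_eq0 !eqz_nat => /eqP/val_inj h1 /eqP/val_inj h2 /eqP/val_inj h3 /eqP/val_inj h4.
  by case: x y h1 h2 h3 h4 {fxy uE u plane} => [[[? ?] ?] ?] [[[? ?] ?] ?] /= -> -> -> ->.
have mltp : (m < p)%N by nia.
exists u; split => //.
  apply: contra u0 => /eqP/qmapz_eq0[v uv]; rewrite uv.
  suff -> : v = 0 by rewrite /qscale /= !mulr0.
  have small (i j : I) (t : int) : i%:Z - j%:Z = p%:Z * t -> t = 0.
    by have := bnd i j; nia.
  move: uv; rewrite uE; case: v => [[[a b] c] d] /=.
  by case=> /small -> /small -> /small -> /small ->.
have N0 : 0 < qnorm u.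
  rewrite lt_def qnorm_ge0 andbT; apply: contra u0 => /eqP/qnorm_eq0 ->.
  exact: eqxx.
(* The coordinates of [u] are at most [m] in absolute value and [m ^ 2 < p]. Together with
   divisibility by [p] this leaves the norms [p], [2 p] and [3 p]. *)
have N4 : qnorm u < 4%:Z * p%:Z.
  rewrite uE /qnorm; have := bnd x.1.1.1 y.1.1.1; have := bnd x.1.1.2 y.1.1.2.
  have := bnd x.1.2 y.1.2; have := bnd x.2 y.2.
  have sq (t : int) : `|t| <= m%:Z -> t ^+ 2 <= m%:Z ^+ 2 by nia.
  move=> /sq h1 /sq h2 /sq h3 /sq h4.
  have : m%:Z ^+ 2 < p%:Z by rewrite expr2 -PoszM ltz_nat mulnn.
  lia.
have : (p %| qnorm u)%Z.
  rewrite (dvdz_pcharf pF) -qnorm_mapz; move: plane; rewrite /on_plane.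
  case: (qmapz 'F_p u) => [[[a b] c] d] [-> ->]; rewrite /qnorm.
  have -> : a ^+ 2 + b ^+ 2 + (z.1 * a - z.2 * b) ^+ 2 + (z.2 * a + z.1 * b) ^+ 2
    = (1 + (z.1 ^+ 2 + z.2 ^+ 2)) * (a ^+ 2 + b ^+ 2) by ring.
  by rewrite zE subrr mul0r.
case/dvdzP => -[t|t] tE; rewrite tE in N0 N4; last by move: N0; rewrite pmulr_lgt0 // ltz_nat; lia.
by exists t; [nia|rewrite tE -PoszM].
Qed.

(** [F_p[i]] may have zero divisors, so [w] cannot be cancelled from [z w = z' w]. Multiplying by
    the conjugates of [z] and [z'], both of norm [- 1], gives the same relation for the conjugate
    slopes ([f1], [f2]); both together annihilate each coordinate of [w] times each of [z - z']. *)
Lemma on_plane_inj z z' x : z \in isotropic_slopes -> z' \in isotropic_slopes ->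
  qmapz 'F_p x != 0 -> on_plane z x -> on_plane z' x -> z = z'.
Proof.
case: z z' => [r s] [r' s']; rewrite !inE /on_plane /= => /eqP n /eqP n'.
case: (qmapz _ x) => [[[a b] c] d] x0 [h1 h2] [h1' h2'].
have e1 : r * a - s * b = r' * a - s' * b by rewrite -h1.
have e2 : s * a + r * b = s' * a + r' * b by rewrite -h2.
have ac (t : 'F_p) : t = - ((r ^+ 2 + s ^+ 2) * t) by rewrite n mulN1r opprK.
have ac' (t : 'F_p) : t = - ((r' ^+ 2 + s' ^+ 2) * t) by rewrite n' mulN1r opprK.
have f1 : a * r' + b * s' = a * r + b * s.
  rewrite (ac (a * r' + b * s')) [RHS]ac'; congr (- _).
  transitivity ((r * a - s * b) * (r * r' - s * s') + (s * a + r * b) * (r * s' + s * r')); first by ring.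
  by rewrite e1 e2; ring.
have f2 : b * r' - a * s' = b * r - a * s.
  rewrite (ac (b * r' - a * s')) [RHS]ac'; congr (- _).
  transitivity ((s * a + r * b) * (r * r' - s * s') - (r * a - s * b) * (r * s' + s * r')); first by ring.
  by rewrite e1 e2; ring.
have two := Fp_two_neq0.
have z0 t v : 2%:R * (t * v) = 0 :> 'F_p -> t != 0 -> v = 0.
  by move=> /eqP; rewrite !mulf_eq0 (negbTE two) /= => /orP[->//|/eqP].
have g1 : 2%:R * (a * (r - r')) = 0.
  transitivity ((r * a - s * b) - (r' * a - s' * b) - ((a * r' + b * s') - (a * r + b * s))); first by ring.
  by rewrite e1 f1 !subrr.
have g2 : 2%:R * (a * (s - s')) = 0.
  transitivity ((s * a + r * b) - (s' * a + r' * b) + ((b * r' - a * s') - (b * r - a * s))); first by ring.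
  by rewrite e2 f2 !subrr addr0.
have g3 : 2%:R * (b * (s - s')) = 0.
  transitivity ((r' * a - s' * b) - (r * a - s * b) - ((a * r' + b * s') - (a * r + b * s))); first by ring.
  by rewrite e1 f1 !subrr.
have g4 : 2%:R * (b * (r - r')) = 0.
  transitivity ((s * a + r * b) - (s' * a + r' * b) - ((b * r' - a * s') - (b * r - a * s))); first by ring.
  by rewrite e2 f2 !subrr.
have [a0|a0] := eqVneq a 0; last first.
  by congr (_, _); apply/eqP; rewrite -subr_eq0; apply/eqP; apply: (z0 a).
have [b0|b0] := eqVneq b 0; last first.
  by congr (_, _); apply/eqP; rewrite -subr_eq0; apply/eqP; apply: (z0 b).
by move: x0; rewrite h1 h2 a0 b0 !mulr0 subr0 addr0 eqxx.
Qed.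

Lemma sum_sqr_le3 (c : nat) (t u v w : int) : (c <= 3)%N ->
  t ^+ 2 + u ^+ 2 + v ^+ 2 + w ^+ 2 = c%:Z ^+ 2 ->
  [/\ `|t| <= 3, `|u| <= 3, `|v| <= 3 & `|w| <= 3].
Proof.
move=> c3 h.
have sq3 (s : int) : s ^+ 2 <= c%:Z ^+ 2 -> `|s| <= 3.
  rewrite -(real_normK (num_real s)) ler_sqr ?nnegrE //.
  by move/le_trans; apply; rewrite lez_nat.
have := sqr_ge0 t; have := sqr_ge0 u; have := sqr_ge0 v; have := sqr_ge0 w.
by move=> *; split; apply: sq3; rewrite -h; lia.
Qed.

(** Divided by [p], the values of [h] have norm [c ^ 2 <= 9], hence coordinates between [- 3] and
    [3]. *)
Lemma card_small_quotients (T : finType) (A : {set T}) (h : T -> quat int) (c : nat) :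
  (c <= 3)%N -> {in A &, injective h} ->
  (forall x, x \in A -> qmapz 'F_p (h x) = 0 /\ qnorm (h x) = (c * p)%N%:Z ^+ 2) ->
  (#|A| <= 7 ^ 4)%N.
Proof.
move=> c3 h_inj hA; have p0 : (0 < p)%N by apply: prime_gt0.
have ex x : exists y : quat int, x \in A -> h x = qscale p%:Z y /\ qnorm y = c%:Z ^+ 2.
  have [/hA[/qmapz_eq0[y hy] Nh]|_] := boolP (x \in A); last by exists 0.
  exists y => _; split=> //; apply: (@mulfI _ (p%:Z ^+ 2)).
    by rewrite expf_eq0 /= eqz_nat -lt0n.
  by rewrite -qnorm_scale -hy Nh PoszM exprMn mulrC.
have [g gP] := fin_all_exists ex.
pose enc (t : int) : 'I_7 := inord (absz (t + 3)).
pose phi x := let: (a, b, c, d) := g x in (enc a, enc b, enc c, enc d).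
have encK (s t : int) : `|s| <= 3 -> `|t| <= 3 -> enc s = enc t -> s = t.
  move=> hs ht /(congr1 val); rewrite /= !inordK; lia.
have -> : (7 ^ 4 = #|{: 'I_7 * 'I_7 * 'I_7 * 'I_7}|)%N by rewrite !card_prod !card_ord.
rewrite -(card_in_imset (f := phi)); first exact: max_card.
move=> x y xA yA; have [hx nx] := gP x xA; have [hy ny] := gP y yA.
rewrite /phi => e; apply: h_inj => //; rewrite hx hy; congr qscale.
case: (g x) (g y) nx ny e => [[[a b] c1] d] [[[a' b'] c1'] d']; rewrite /qnorm => nx ny.
have [? ? ? ?] := sum_sqr_le3 c3 nx; have [? ? ? ?] := sum_sqr_le3 c3 ny.
by case=> /encK -> // /encK -> // /encK -> // /encK -> //.
Qed.

(** Every element of [A] lies in a maximal independent set or is related to one of its members. *)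
Lemma independent_subset (T : finType) (A : {set T}) (e : rel T) K :
  symmetric e -> (forall x, x \in A -> (#|[set y in A | e x y]| <= K)%N) ->
  exists2 I : {set T}, I \subset A & (forall x y, x \in I -> y \in I -> x != y -> ~~ e x y) /\
    (#|A| <= #|I| * K.+1)%N.
Proof.
move=> e_sym eK.
pose indep (I : {set T}) := (I \subset A) &&
  [forall x in I, forall y in I, (x != y) ==> ~~ e x y].
have indep0 : indep set0.
  by rewrite /indep sub0set; apply/forall_inP => x; rewrite inE.
have [I /maxsetP[/andP[IA /forall_inP Ii] Imax] _] := maxset_exists indep0.
exists I => //; split.
  by move=> x y xI yI; move/forall_inP: (Ii x xI) => /(_ y yI) /implyP.
apply: (@leq_trans #|\bigcup_(x in I) (x |: [set y in A | e x y])|); last first.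
  apply: (@leq_trans (\sum_(x in I) #|x |: [set y in A | e x y]|)%N).
    elim/big_rec2: _ => [|x m B _ hB]; first by rewrite cards0.
    by rewrite cardsU (leq_trans (leq_subr _ _)) // leq_add2l.
  rewrite -sum_nat_const; apply: leq_sum => x xI; rewrite cardsU1.
  by have := eK x (subsetP IA x xI); case: (_ \notin _); lia.
apply: subset_leq_card; apply/subsetP => y yA; apply/bigcupP.
have [yI|yI] := boolP (y \in I); first by exists y; rewrite // setU11.
have [/exists_inP[x xI exy]|] := boolP [exists x in I, e x y].
  by exists x; rewrite // !inE yA exy orbT.
rewrite negb_exists => /forallP noe; have /negP[] := yI.
have <- : y |: I = I; last exact: setU11.
apply: Imax; last exact: subsetUr.
rewrite /indep subUset sub1set yA IA; apply/forall_inP => x; rewrite in_setU1 => xI.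
apply/forall_inP => x'; rewrite in_setU1 => xI'; apply/implyP => xx'.
have ne z : z \in I -> ~~ e z y by move=> zI; have := noe z; rewrite zI.
case/predU1P: xI xx' => [-> |xI]; case/predU1P: xI' => [-> |xI'].
- by rewrite eqxx.
- by move=> _; rewrite e_sym ne.
- by move=> _; rewrite ne.
- by move=> xx'; move/forall_inP: (Ii x xI) => /(_ x' xI') /implyP; apply.
Qed.

(** The factor 3 comes from keeping the most frequent norm [c p]. Two slopes conflict when one of
    the two products vanishes modulo [p]; each slope has at most [2 * 7 ^ 4 = 4802] conflicts, and
    an independent set costs the factor 4803. *)
Lemma isotropic_generators : exists c D (al : 'I_D -> quat int),
  [/\ (0 < c <= 3)%N, (p - 2 <= 3 * (D * 4803))%N,
      forall i, qnorm (al i) = (c * p)%N%:Z &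
      forall i j, i != j -> qmapz 'F_p (qmul (al i) (qconj (al j))) != 0 /\
                            qmapz 'F_p (qmul (qconj (al i)) (al j)) != 0].
Proof.
have p0 : (0 < p)%N by apply: prime_gt0.
have ex z : exists x : quat int, z \in isotropic_slopes -> [/\ on_plane z x, qmapz 'F_p x != 0 &
      exists2 c : nat, (0 < c <= 3)%N & qnorm x = (c * p)%N%:Z].
  have [/small_quat_on_plane[x hx]|_] := boolP (z \in isotropic_slopes); last by exists 0.
  by exists x.
have [f fP] := fin_all_exists ex.
pose cl c := [set z in isotropic_slopes | qnorm (f z) == (c * p)%N%:Z].
have [c c3 cZ] : exists2 c, (0 < c <= 3)%N & (#|isotropic_slopes| <= 3 * #|cl c|)%N.
  have sub : isotropic_slopes \subset cl 1%N :|: (cl 2%N :|: cl 3%N).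
    apply/subsetP => z zZ; have [_ _ [c c3 nc]] := fP z zZ; rewrite !inE nc.
    move: zZ; rewrite inE => -> /=.
    by case: c c3 {nc} => [|[|[|[|]]]] // _; rewrite eqxx ?orbT.
  have := subset_leq_card sub; rewrite !cardsU => hs.
  case: (leqP #|isotropic_slopes| (3 * #|cl 1%N|)) => h1; first by exists 1%N.
  case: (leqP #|isotropic_slopes| (3 * #|cl 2%N|)) => h2; first by exists 2%N.
  by exists 3%N => //; lia.
have clP z : z \in cl c -> z \in isotropic_slopes /\ qnorm (f z) = (c * p)%N%:Z.
  by rewrite inE => /andP[-> /eqP ->].
have f_inj : {in cl c &, injective f}.
  move=> z z' /clP[zZ _] /clP[zZ' _] ff; have [h1 h2 _] := fP z zZ; have [h1' _ _] := fP z' zZ'.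
  by apply: (on_plane_inj zZ zZ' h2 h1); rewrite ff.
pose e z z' := (qmapz 'F_p (qmul (f z) (qconj (f z'))) == 0)
            || (qmapz 'F_p (qmul (qconj (f z)) (f z')) == 0).
have e_sym : symmetric e.
  move=> z z'; have conj0 x : (qmapz 'F_p (qconj x) == 0) = (qmapz 'F_p x == 0).
    rewrite qmapz_conj; apply/eqP/eqP => [h|->]; last exact: qconj0.
    by rewrite -[qmapz _ _]qconjK h qconj0.
  by rewrite /e -(conj0 (qmul (f z) _)) -(conj0 (qmul (qconj (f z)) _)) !qconjM !qconjK.
have cp0 : (c * p)%N%:Z != 0 by rewrite eqz_nat muln_eq0; case/andP: c3; lia.
have scal_inj t : t != 0 -> injective (qscale t : quat int -> quat int).
  move=> t0 [[[a b] c1] d] [[[a' b'] c1'] d'] [] /(mulfI t0) -> /(mulfI t0) ->.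
  by move=> /(mulfI t0) -> /(mulfI t0) ->.
have eK z : z \in cl c -> (#|[set z' in cl c | e z z']| <= 4802)%N.
  move=> /clP[zZ nz].
  have -> : [set z' in cl c | e z z'] =
      [set z' in cl c | qmapz 'F_p (qmul (f z) (qconj (f z'))) == 0]
      :|: [set z' in cl c | qmapz 'F_p (qmul (qconj (f z)) (f z')) == 0].
    by apply/setP => z'; rewrite in_setU [LHS]in_set [X in _ = X || _]in_set [X in _ = _ || X]in_set -andb_orr.
  rewrite cardsU; apply: leq_trans (leq_subr _ _) _.
  rewrite (_ : 4802 = 7 ^ 4 + 7 ^ 4)%N //; apply: leq_add.
    apply: (@card_small_quotients _ _ (fun z' => qmul (f z) (qconj (f z'))) c); first by case/andP: c3.
      move=> u v; rewrite in_set => /andP[uC _]; rewrite in_set => /andP[vC _] /=.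
      move/(congr1 (qmul (qconj (f z)))); rewrite !qmulA qmul_conjl nz !qmul_scal.
      move/(scal_inj _ cp0)/(congr1 (@qconj _)); rewrite !qconjK.
      exact: f_inj.
    move=> u; rewrite in_set => /andP[/clP[_ nu] /eqP ->].
    by rewrite qnormM qnorm_conj nz nu expr2.
  apply: (@card_small_quotients _ _ (fun z' => qmul (qconj (f z)) (f z')) c); first by case/andP: c3.
    move=> u v; rewrite in_set => /andP[uC _]; rewrite in_set => /andP[vC _] /=.
    move/(congr1 (qmul (f z))); rewrite !qmulA qmul_conjr nz !qmul_scal.
    move/(scal_inj _ cp0); exact: f_inj.
  move=> u; rewrite in_set => /andP[/clP[_ nu] /eqP ->].
  by rewrite qnormM qnorm_conj nz nu expr2.
have [I IA [Ii cI]] := independent_subset e_sym eK.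
exists c, #|I|, (fun i => f (enum_val i)); split=> //.
- by have := card_isotropic_slopes; lia.
- by move=> i; have /clP[] := subsetP IA _ (enum_valP i).
move=> i j ij; have := Ii _ _ (enum_valP i) (enum_valP j).
by rewrite (inj_eq enum_val_inj) => /(_ ij); rewrite negb_or => /andP[].
Qed.

End PrimeField.

(** * Unit quaternions modulo a power of five *)

Section FivePower.
Variable r : nat.
Hypothesis r_gt0 : (0 < r)%N.
Let Q := (5 ^ r)%N.

Let Q_gt1 : (1 < Q)%N. Proof. by rewrite -(expn0 5) ltn_exp2l. Qed.
Let five_dvdQ : (5 %| Q)%N. Proof. by rewrite dvdn_exp. Qed.

Lemma ZQ_natr_unit n : ((n%:R : 'Z_Q) \is a GRing.unit) = ~~ (5 %| n)%N.
Proof. by rewrite unitZpE // coprime_pexpl // prime_coprime. Qed.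

Lemma ZQ_unit (x : 'Z_Q) : (x \is a GRing.unit) = ~~ (5 %| val x)%N.
Proof. by rewrite -{1}[x]natr_Zp ZQ_natr_unit. Qed.

Lemma ZQ_natr_eq0 n : (n%:R == 0 :> 'Z_Q) = (Q %| n)%N.
Proof. by rewrite -val_eqE /= val_Zp_nat. Qed.

Lemma ZQ_intr_eq0 (z : int) : (z%:~R == 0 :> 'Z_Q) = (Q %| absz z)%N.
Proof. by case: z => n; rewrite ?NegzE ?rmorphN ?oppr_eq0 /= ZQ_natr_eq0. Qed.

(** The condition modulo 5 prevents [y] from being congruent to [- x], so [x + y] is a unit and
    cancels from [(x - y) (x + y) = 0]. *)
Lemma ZQ_sqr_inj (x y : 'Z_Q) : x \is a GRing.unit ->
  (val x %% 5 < 3)%N = (val y %% 5 < 3)%N -> x ^+ 2 = y ^+ 2 -> x = y.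
Proof.
move=> ux hxy /eqP; rewrite -subr_eq0 subr_sqr.
have uxy : x + y \is a GRing.unit \/ (y = x).
  left; rewrite -[x]natr_Zp -[y]natr_Zp -natrD ZQ_natr_unit.
  move: ux hxy; rewrite ZQ_unit /=; move: (nat_of_ord x) (nat_of_ord y) => m n.
  by rewrite !dvdn_eq; lia.
case: uxy => [uxy|->//]; rewrite -(mul0r (x + y)) (inj_eq (mulIr uxy)) subr_eq0.
by move/eqP.
Qed.

Definition sphere := {x : quat 'Z_Q | qnorm x == 1}.

(** Some coordinate is a unit, as 5 does not divide 1. Its index, one bit as in [ZQ_sqr_inj] and the
    other three coordinates determine the point. *)
Lemma card_sphere : (#|{: sphere}| <= 8 * Q ^ 3)%N.
Proof.
pose half (x : 'Z_Q) := (val x %% 5 < 3)%N.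
pose enc (x : sphere) : 'I_4 * bool * ('Z_Q * 'Z_Q * 'Z_Q) :=
  let: (a, b, c, d) := val x in
  if a \is a GRing.unit then (inord 0, half a, (b, c, d))
  else if b \is a GRing.unit then (inord 1, half b, (a, c, d))
  else if c \is a GRing.unit then (inord 2, half c, (a, b, d))
  else (inord 3, half d, (a, b, c)).
have ux a b c d : a ^+ 2 + b ^+ 2 + c ^+ 2 + d ^+ 2 = 1 :> 'Z_Q ->
   ~~ (a \is a GRing.unit) -> ~~ (b \is a GRing.unit) -> ~~ (c \is a GRing.unit) ->
   d \is a GRing.unit.
  rewrite !ZQ_unit !negbK -{1}[a]natr_Zp -{1}[b]natr_Zp -{1}[c]natr_Zp -{1}[d]natr_Zp.
  rewrite -!natrX -!natrD => e1.
  have := congr1 (@nat_of_ord _) (e1 : _ = 1%:R :> 'Z_Q).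
  rewrite !val_Zp_nat // => h da db dc.
  apply/negP => dd; have : (5 %| 1 %% Q)%N.
    rewrite -h /dvdn modn_dvdm // -/(dvdn _ _).
    by rewrite !dvdn_add // dvdn_exp.
  by rewrite modn_small.
have enc_inj : injective enc.
  move=> [[[[a b] c] d] /= nx] [[[[a' b'] c'] d'] /= ny] h; apply: val_inj => /=.
  move: h; rewrite /enc /=; move/eqP: nx => nx; move/eqP: ny => ny.
  have i4 (i j : nat) : inord i = inord j :> 'I_4 -> (i < 4)%N -> (j < 4)%N -> i = j.
    by move=> /(congr1 val) + i4 j4; rewrite /= !inordK.
  have key (u v u' : 'Z_Q) : u \is a GRing.unit -> half u = half u' ->
      u ^+ 2 + v = 1 -> u' ^+ 2 + v = 1 -> u = u'.
    by move=> uu hu h1 h2; apply: ZQ_sqr_inj => //; apply: (addIr v); rewrite h1 h2.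
  case: (boolP (a \is a GRing.unit)) => ua; case: (boolP (a' \is a GRing.unit)) => ua'.
  - move=> e; have hh : half a = half a' := congr1 (fun t => t.1.2) e.
    have hb : b = b' := congr1 (fun t => t.2.1.1) e.
    have hc : c = c' := congr1 (fun t => t.2.1.2) e.
    have hd : d = d' := congr1 (fun t => t.2.2) e.
    clear e; rewrite -hb -hc -hd in ny *; congr (_, _, _, _).
    by apply: (key a (b ^+ 2 + c ^+ 2 + d ^+ 2) a' ua hh); rewrite !addrA.
  - by case: ifP => _; [|case: ifP => _] => /(congr1 (fun t => t.1.1))/i4/(_ isT isT).
  - by case: ifP => _; [|case: ifP => _] => /(congr1 (fun t => t.1.1))/i4/(_ isT isT).
  case: (boolP (b \is a GRing.unit)) => ub; case: (boolP (b' \is a GRing.unit)) => ub'.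
  - move=> e; have hh : half b = half b' := congr1 (fun t => t.1.2) e.
    have ha : a = a' := congr1 (fun t => t.2.1.1) e.
    have hc : c = c' := congr1 (fun t => t.2.1.2) e.
    have hd : d = d' := congr1 (fun t => t.2.2) e.
    clear e; rewrite -ha -hc -hd in ny *; congr (_, _, _, _).
    apply: (key b (a ^+ 2 + c ^+ 2 + d ^+ 2) b' ub hh).
      by rewrite -nx; ring.
    by rewrite -ny; ring.
  - by case: ifP => _ => /(congr1 (fun t => t.1.1))/i4/(_ isT isT).
  - by case: ifP => _ => /(congr1 (fun t => t.1.1))/i4/(_ isT isT).
  case: (boolP (c \is a GRing.unit)) => uc; case: (boolP (c' \is a GRing.unit)) => uc'.
  - move=> e; have hh : half c = half c' := congr1 (fun t => t.1.2) e.
    have ha : a = a' := congr1 (fun t => t.2.1.1) e.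
    have hb : b = b' := congr1 (fun t => t.2.1.2) e.
    have hd : d = d' := congr1 (fun t => t.2.2) e.
    clear e; rewrite -ha -hb -hd in ny *; congr (_, _, _, _).
    apply: (key c (a ^+ 2 + b ^+ 2 + d ^+ 2) c' uc hh).
      by rewrite -nx; ring.
    by rewrite -ny; ring.
  - by move/(congr1 (fun t => t.1.1))/i4/(_ isT isT).
  - by move/(congr1 (fun t => t.1.1))/i4/(_ isT isT).
  move=> e; have hh : half d = half d' := congr1 (fun t => t.1.2) e.
    have ha : a = a' := congr1 (fun t => t.2.1.1) e.
    have hb : b = b' := congr1 (fun t => t.2.1.2) e.
    have hc : c = c' := congr1 (fun t => t.2.2) e.
    clear e; rewrite -ha -hb -hc in ny *; congr (_, _, _, _).
  apply: (key d (a ^+ 2 + b ^+ 2 + c ^+ 2) d' (ux _ _ _ _ nx ua ub uc) hh).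
    by rewrite -nx; ring.
  by rewrite -ny; ring.
apply: leq_trans (leq_card enc enc_inj) _.
rewrite !card_prod card_bool !card_ord Zp_cast //.
by rewrite !expnS expn0 muln1 !mulnA; apply: leqnn.
Qed.


Definition sphere_mul (x g : sphere) : sphere.
Proof.
by exists (qmul (val x) (val g)); rewrite qnormM (eqP (valP x)) (eqP (valP g)) mulr1.
Defined.

Lemma sphere_mul_inj g : injective (sphere_mul^~ g).
Proof.
move=> x y /(congr1 val) /= /(congr1 (fun z => qmul z (qconj (val g)))).
rewrite -!qmulA qmul_conjr (eqP (valP g)) !qmulq1; exact: val_inj.
Qed.

(* The norm of [w] makes its real part equal to [t] up to sign modulo [Q ^ 2],
   so that a congruence modulo [Q] determines [w] although [t] may exceed [Q]. *)
Lemma qmapz_scal_eq (w : quat int) (t : nat) :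
  ~~ (5 %| 2 * t)%N -> (2 * t < Q ^ 2)%N -> qnorm w = t%:Z ^+ 2 ->
  qmapz 'Z_Q w = qscal t%:R -> w = qscal t%:Z.
Proof.
case: w => [[[a b] c] d] t5 tQ; rewrite /qnorm => N [ha hb hc hd].
have dvd0 (z : int) : z%:~R = 0 :> 'Z_Q -> exists u, z = u * Q%:Z.
  by move/eqP; rewrite ZQ_intr_eq0 => zQ; apply/dvdzP; rewrite dvdzE.
have [u uE] : exists u, a - t%:Z = u * Q%:Z by apply: dvd0; rewrite intrB ha subrr.
have [b' bE] := dvd0 b hb; have [c' cE] := dvd0 c hc; have [d' dE] := dvd0 d hd.
have Q0 : 0 < Q%:Z by rewrite ltz_nat (ltnW Q_gt1).
have e1 : u * (a + t%:Z) = - (b' ^+ 2 + c' ^+ 2 + d' ^+ 2) * Q%:Z.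
  apply: (mulfI (lt0r_neq0 Q0)); transitivity (a ^+ 2 - t%:Z ^+ 2).
    by rewrite mulrA (mulrC Q%:Z) -uE; ring.
  by rewrite -N bE cE dE; ring.
(* [Q] divides both [u (a + t)] and [u (a - t)], hence [2 t u], and [2 t] is prime to 5. So [a - t]
   is a multiple of [Q ^ 2], while it is at most [2 t] in absolute value. *)
have /dvdzP[v vE] : (Q%:Z %| u)%Z.
  rewrite -(@Gauss_dvdzl _ _ (2 * t)%N%:Z); last first.
    by rewrite coprimezE /= coprime_pexpl // prime_coprime.
  have -> : u * (2 * t)%N%:Z = u * (a + t%:Z) - u * (a - t%:Z) by rewrite PoszM; ring.
  by rewrite e1 uE; apply/dvdzP; exists (- (b' ^+ 2 + c' ^+ 2 + d' ^+ 2) - u * u); ring.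
have at2 : a ^+ 2 <= t%:Z ^+ 2.
  by rewrite -N -!addrA lerDl !addr_ge0 ?sqr_ge0.
have at1 : `|a| <= t%:Z.
  by move: at2; rewrite -(real_normK (num_real a)) ler_sqr ?nnegrE.
have v0 : v = 0.
  move: uE; rewrite vE => avE.
  have bnd : `|v * Q%:Z * Q%:Z| < Q%:Z * Q%:Z.
    rewrite -avE; apply: le_lt_trans (ler_normB _ _) _; rewrite (@ger0_norm _ t%:Z) //.
    apply: le_lt_trans (lerD at1 (lexx _)) _.
    by move: tQ; rewrite -mulnn mul2n -addnn -ltz_nat PoszD PoszM.
  move: bnd; rewrite -mulrA normrM [X in _ * X]ger0_norm ?mulr_ge0 //.
  rewrite gtr_pMl ?mulr_gt0 //; clear; lia.
have aE : a = t%:Z by apply/eqP; rewrite -subr_eq0 uE vE v0 !mul0r.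
have N0 : b ^+ 2 + c ^+ 2 + d ^+ 2 = 0.
  by apply: (addrI (t%:Z ^+ 2)); rewrite addr0 -[RHS]N aE !addrA.
have [-> -> ->] : [/\ b = 0, c = 0 & d = 0] by clear -N0; split; nia.
by rewrite aE.
Qed.

End FivePower.

(** * Products of generators and closed walks *)

Fixpoint qprod (R : comNzRingType) (x : nat -> quat R) n : quat R :=
  if n is n'.+1 then qmul (qprod x n') (x n') else qscal 1.

Lemma qprod0 (R : comNzRingType) (x : nat -> quat R) : qprod x 0 = qscal 1.
Proof. by []. Qed.

Lemma qprodS (R : comNzRingType) (x : nat -> quat R) n :
  qprod x n.+1 = qmul (qprod x n) (x n).
Proof. by []. Qed.

Lemma qmapz_qprod (R : comNzRingType) x n :
  qmapz R (qprod x n) = qprod (qmapz R \o x) n.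
Proof. by elim: n => [|n IH]; rewrite ?qprod0 ?qmapz_scal // !qprodS qmapzM IH. Qed.

Lemma qnorm_qprod (R : comNzRingType) (x : nat -> quat R) n t :
  (forall b, qnorm (x b) = t) -> qnorm (qprod x n) = t ^+ n.
Proof.
move=> xt; elim: n => [|n IH]; first by rewrite qprod0 qnorm_scal expr1n.
by rewrite qprodS qnormM IH xt exprSr.
Qed.

(** By [qmul3_eq0], a vanishing product has either a vanishing shorter prefix or a vanishing product
    of its last two factors. *)
Lemma qprod_neq0 (F : fieldType) (x : nat -> quat F) n : 2%:R != 0 :> F -> (1 < n)%N ->
  (forall b, qnorm (x b) = 0) ->
  (forall b, (b.+1 < n)%N -> qmul (x b) (x b.+1) != 0) -> qprod x n != 0.
Proof.
move=> two n1 Nx xx; have [m] := ubnP n; move: (leqnn n).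
move: {1 3 4}n => b; elim: m b => // m IH [|[|b]] bn bm.
- by apply/negP => /eqP[/eqP]; rewrite oner_eq0.
- rewrite qprodS qprod0 qmul1; apply: contra (xx 0%N n1) => /eqP ->; rewrite qmul0 eqxx //.
rewrite !qprodS; apply/negP => /eqP/(qmul3_eq0 two (Nx b))[] /eqP; apply/negP; last exact: xx.
by apply: (IH b.+1); [exact: ltnW|exact: bm].
Qed.

Section AlternatingFree.
Variables (k p c D r : nat) (al : 'I_D -> quat int).
Hypotheses (k_gt0 : (0 < k)%N) (p_pr : prime p) (p_gt5 : (5 < p)%N).
Hypotheses (c_le3 : (0 < c <= 3)%N) (D_gt0 : (0 < D)%N) (r_gt0 : (0 < r)%N).
Let M := (c * p)%N.
Hypothesis al_norm : forall i, qnorm (al i) = M%:Z.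
Hypothesis al_neq0 : forall i j, i != j ->
  qmapz 'F_p (qmul (al i) (qconj (al j))) != 0 /\
  qmapz 'F_p (qmul (qconj (al i)) (al j)) != 0.
Hypothesis Q_large : (2 * M ^ k < (5 ^ r) ^ 2)%N.
Let Q := (5 ^ r)%N.

Let five_ndvd : ~~ (5 %| 2 * M ^ k)%N.
Proof.
rewrite !Euclid_dvdM // Euclid_dvdX // k_gt0 andbT /= /M Euclid_dvdM // negb_or.
by rewrite (dvdn_prime2 _ p_pr) // [5 == p]ltn_eqF // andbT; case: c c_le3 => [|[|[|[|]]]].
Qed.

Let M_unit : (M%:R : 'Z_Q) \is a GRing.unit.
Proof.
rewrite ZQ_natr_unit //; apply: contra five_ndvd => h.
by rewrite dvdn_mull // dvdn_exp.
Qed.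

Let i0 : 'I_D := Ordinal D_gt0.
Local Notation qm := (qmapz 'Z_Q).

(** [M] need not be a square modulo [Q], so the norm is made 1 with the fixed quaternion [al i0];
    this factor cancels between two consecutive steps of a walk. *)
Let gen_norm i :
  qnorm (qscale M%:R^-1 (qmul (qm (al i)) (qconj (qm (al i0))))) == 1.
Proof.
rewrite qnorm_scale qnormM qnorm_conj !qnorm_mapz !al_norm expr2.
by rewrite mulrACA !mulVr // mulr1.
Qed.

Let gen i : sphere r := exist (fun x => is_true (qnorm x == 1)) _ (gen_norm i).

Lemma alternating_free_sphere : exists g : 'I_D -> sphere r -> sphere r,
  (forall i, injective (g i)) /\ alternating_free k g.
Proof.
exists (fun i x => sphere_mul x (gen i)); split=> [i|]; first exact: sphere_mul_inj.
move=> y idx up down idxN ycl.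
(* A walk goes forward along a generator at even steps and backward at odd ones, where the inverse
   of [al] is its conjugate up to the factor [M]. *)
pose x b := if odd b then qconj (al (idx b)) else al (idx b).
pose Y b := val (y b).
have genE i : qmul (val (gen i)) (qm (al i0)) = qm (al i).
  rewrite /= qmul_scalel -qmulA qmul_conjl qnorm_mapz al_norm.
  have -> (s : 'Z_Q) z : qmul z (qscal s) = qscale s z.
    by rewrite -[qscal s]qscaleq1 qmul_scaler qmulq1.
  by rewrite qscaleA mulVr // qscale1.
have step a : (a < k)%N ->
    qmul (Y (2 * a)%N) (qm (qmul (x (2 * a)%N) (x (2 * a).+1))) = qscale M%:R (Y (2 * a).+2).
  move=> ak; have od : odd (2 * a) = false by rewrite mul2n odd_double.
  have -> : x (2 * a)%N = al (idx (2 * a)%N) by rewrite /x od.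
  have -> : x (2 * a).+1 = qconj (al (idx (2 * a).+1)) by rewrite /x oddS od.
  rewrite qmapzM qmapz_conj qmulA.
  have -> : qmul (Y (2 * a)%N) (qm (al (idx (2 * a)%N))) =
            qmul (Y (2 * a).+2) (qm (al (idx (2 * a).+1))).
    have := up a ak; rewrite (down a ak) => /(congr1 val)/(congr1 (fun z => qmul z (qm (al i0)))).
    by rewrite /= -!qmulA !genE => ->.
  rewrite -qmulA qmul_conjr qnorm_mapz al_norm -[qscal _]qscaleq1 qmul_scaler qmulq1.
  by [].
have walk a : (a <= k)%N -> qmul (Y 0%N) (qm (qprod x (2 * a))) = qscale (M ^ a)%:R (Y (2 * a)%N).
  elim: a => [|a IH] ak; first by rewrite qmapz_scal qmulq1 qscale1.
  rewrite (_ : 2 * a.+1 = (2 * a).+2)%N ?mulnS // !qprodS -qmulA qmapzM qmulA.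
  rewrite IH 1?ltnW // qmul_scalel step // qscaleA -natrM expnSr //.
have w_scal : qprod x (2 * k) = qscal (M ^ k)%N%:Z.
  apply: (@qmapz_scal_eq r) => //.
    rewrite (@qnorm_qprod _ _ _ M%:Z) => [|b].
      by rewrite -!natz natrX -exprM mulnC.
    by rewrite /x; case: ifP => _; rewrite ?qnorm_conj al_norm.
  have := walk k (leqnn k); rewrite /Y ycl.
  move/(congr1 (qmul (qconj (val (y 0%N))))).
  rewrite qmulA qmul_conjl (eqP (valP (y 0%N))) qmul1 => ->.
  by rewrite qmul_scaler qmul_conjl (eqP (valP (y 0%N))) qscaleq1.
have pF := pchar_Fp p_pr.
have := @qprod_neq0 _ (qmapz 'F_p \o x) (2 * k) (Fp_two_neq0 p_pr p_gt5).
rewrite -qmapz_qprod w_scal qmapz_scal.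
have M0 : (M%:R : 'F_p) = 0 by apply/eqP; rewrite Fp_natr_eq0 // dvdn_mull.
suff -> : ((M ^ k)%N%:Z%:~R : 'F_p) = 0.
  rewrite eqxx => h; suff : false by []; apply: h.
  - by rewrite mul2n -addnn; case: (k) k_gt0 => // k' _; rewrite addSn addnS.
  - move=> b; rewrite /= qnorm_mapz /x; case: ifP => _; rewrite ?qnorm_conj al_norm; exact: M0.
  move=> b bk; rewrite /= -qmapzM /x /=; have /eqP/al_neq0[h1 h2] := idxN b bk.
  by case: (odd b).
by rewrite -[LHS]/((M ^ k)%:R) natrX M0 expr0n; case: (k) k_gt0.
Qed.

End AlternatingFree.

(** [r] is taken minimal with [2 M ^ k < (5 ^ r) ^ 2], whence [(5 ^ r) ^ 2 <= 25 * 2 * M ^ k], with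
    [M <= 3 p]. The bound on [#|V|] is squared to stay within integers. *)
Lemma alternating_free_exists k p : (0 < k)%N -> prime p -> (5 < p)%N ->
  exists (V : finType) D (g : 'I_D -> V -> V),
  [/\ forall i, injective (g i), alternating_free k g, (p - 2 <= 3 * (D * 4803))%N,
      (0 < #|V|)%N & (#|V| ^ 2 <= 64 * (50 * (3 * p) ^ k) ^ 3)%N].
Proof.
move=> k0 p_pr p5; have [c [D [al [c3 cD al_norm al0]]]] := isotropic_generators p_pr p5.
have D0 : (0 < D)%N by case: (D) cD => //; lia.
set M := (c * p)%N in al_norm.
have exr : exists r, (2 * M ^ k < (5 ^ r) ^ 2)%N.
  exists (2 * M ^ k)%N; apply: leq_trans (ltn_expl (2 * M ^ k) (isT : 1 < 5)%N) _.
  by rewrite -mulnn leq_pmull // expn_gt0.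
case: (ex_minnP exr) => r Qr rmin.
have r0 : (0 < r)%N.
  case: (r) Qr => // Qr; move: Qr; rewrite expn0 exp1n ltnS leqn0 muln_eq0 expn_eq0 /=.
  by rewrite muln_eq0 => /andP[/orP[/eqP c0|/eqP pE] _]; [move: c3; rewrite c0|move: p5; rewrite pE].
have Qle : ((5 ^ r) ^ 2 <= 50 * M ^ k)%N.
  rewrite leqNgt; apply/negP => h; have := rmin r.-1.
  rewrite -{1}(prednK r0) (expnS 5) expnMn in h.
  suff h' : (2 * M ^ k < (5 ^ r.-1) ^ 2)%N.
    by move/(_ h'); rewrite leqNgt prednK // leqnn.
  rewrite -(ltn_pmul2l (isT : 0 < 5 ^ 2)%N).
  by rewrite (_ : 5 ^ 2 * (2 * M ^ k) = 50 * M ^ k)%N // mulnA.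
have [g [g_inj g_free]] := alternating_free_sphere k0 p_pr p5 c3 D0 r0 al_norm al0 Qr.
exists (sphere r), D, g; split=> //.
  have n1 : qnorm (qscal 1) == 1 :> 'Z_(5 ^ r) by rewrite qnorm_scal expr1n.
  by apply/card_gt0P; exists (exist (fun x => is_true (qnorm x == 1)) _ n1).
apply: (@leq_trans ((8 * (5 ^ r) ^ 3) ^ 2)); first by rewrite leq_exp2r // card_sphere.
rewrite expnMn -(expnM _ 3 2) (mulnC 3) (expnM _ 2 3) leq_mul2l /= leq_exp2r //.
apply: leq_trans Qle _; rewrite leq_mul2l /=.
by rewrite leq_exp2r // leq_mul2r; case/andP: c3 => _ ->; rewrite orbT.
Qed.

End Quaternion.

(** * Families of Hamilton paths *)

Lemma mem_ham_edges n (s : 'S_n) (u w : 'I_n) : [set u; w] \in ham_edges s ->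
  exists i j : 'I_n, val j = (val i).+1 /\
    ((u = s i /\ w = s j) \/ (w = s i /\ u = s j)).
Proof.
case/imset2P=> i j _; rewrite inE => /eqP ij uw; exists i, j; split=> //.
have ni : s i != s j.
  by rewrite (inj_eq perm_inj) -val_eqE neq_ltn ij ltnSn.
have : u \in [set s i; s j] by rewrite -uw set21.
have : w \in [set s i; s j] by rewrite -uw set22.
have : s i \in [set u; w] by rewrite uw set21.
have : s j \in [set u; w] by rewrite uw set22.
rewrite !inE => hj hi /orP[]/eqP hw /orP[]/eqP hu; rewrite hu hw in hi hj *.
- by rewrite !orbb in hi hj; rewrite (eqP hj) eqxx in ni.
- by right.
- by left.
- by rewrite !orbb in hi hj; rewrite (eqP hi) eqxx in ni.
Qed.

Lemma ham_edges_mulg n (s t : 'S_n) u w :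
  [set u; w] \in ham_edges (s * t)%g -> [set t^-1%g u; t^-1%g w] \in ham_edges s.
Proof.
case/mem_ham_edges=> i [j [ij uw]]; apply/imset2P.
exists i j; rewrite ?inE ?ij ?eqxx //.
by case: uw => -[-> ->]; rewrite !permM !permK // setUC.
Qed.

(* Translating the Hamilton paths of [PP] onto the members of [F] by
   permutations of the vertices never uses the same permutation twice. *)
Lemma ham_family_bound n m (F : {set {set {set 'I_n}}}) (PP : {set 'S_n}) :
  cycle_intersecting m F ->
  (forall s t, s \in PP -> t \in PP -> ~ contains_cycle m (ham_edges s :|: ham_edges t)) ->
  #|F| * #|PP| <= n`!.
Proof.
move=> [Fham Fcyc] PPfree.
have ex P : exists s : 'S_n, P \in F -> P = ham_edges s.
  by have [/Fham[s ->]|_] := boolP (P \in F); [exists s|exists 1%g].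
have [S SP] := fin_all_exists ex.
rewrite -cardsX -card_Sn -(@card_in_imset _ _ (fun Ps => (Ps.2^-1 * S Ps.1)%g)).
  exact: max_card.
move=> [P s] [Q t]; rewrite !in_setX /= => /andP[PF sPP] /andP[QF tPP] e.
have [PQ|PQ] := eqVneq P Q.
  by congr (_, _) => //; move: e; rewrite PQ => /mulIg/invg_inj.
case: (PPfree s t sPP tPP); have [f [f_inj fE]] := Fcyc P Q PF QF PQ.
set tau := (s^-1 * S P)%g in e.
have sE : S P = (s * tau)%g by rewrite mulKVg.
have tE : S Q = (t * tau)%g by rewrite e mulKVg.
exists (fun i => tau^-1%g (f i)); split; first by move=> i j /perm_inj/f_inj.
move=> i j /fE; rewrite !inE (SP P PF) (SP Q QF) sE tE.
by case/orP=> /ham_edges_mulg ->; rewrite ?orbT.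
Qed.

Lemma pigeonhole (A B : finType) (X : {set A}) (f : A -> B) (b0 : B) :
  exists b, #|X| <= #|[set x in X | f x == b]| * #|B|.
Proof.
have [b _ bmax] := @arg_maxnP B b0 predT (fun b => #|[set x in X | f x == b]|) isT.
exists b; rewrite -sum1_card (partition_big f predT) //= mulnC -sum_nat_const.
apply: leq_sum => b' _; apply: leq_trans (bmax b' isT).
by rewrite sum1dep_card; apply: subset_leq_card; apply/subsetP => x; rewrite !inE.
Qed.

(** * Hamilton paths through layers joined by matchings *)

Section LayeredPaths.
Variables (k T v n : nat).
Hypothesis k_ge2 : 2 <= k.
(** The matchings join layers [0] to [T]; the other [2 k + 1] layers, one more than the vertices of
    a [C_{2k}], form the return segments. *)
Let L := T + (2 * k).+2.
Hypothesis n_large : v * L <= n.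

Let L_gt0 : 0 < L. Proof. by rewrite /L addnS. Qed.

Notation matchings := {ffun 'I_T -> {perm 'I_v}}.
Implicit Type M : matchings.

(* Vertex [y * L + t] stands for the pair (y, t) with [y < v] and [t < L]; the
   remaining vertices [p >= v * L] form a tail. All maps are extended by the
   identity so that no bounds have to be carried around. *)
Definition layer_step M (t i : nat) : nat :=
  if insub t is Some t' then if insub i is Some x then M t' x else i else i.

Fixpoint layer_map M (t i : nat) : nat :=
  if t is t'.+1 then layer_step M t' (layer_map M t' i) else i.

(** The path starts its segment [i] at [(i, 0)], follows the matchings to layer [T], keeps the row
    reached there up to layer [L - 1], and goes on to [(i + 1, 0)]. *)
Definition path_pos M (p : nat) : nat := layer_map M (p %% L) (p %/ L) * L + p %% L.

Lemma layer_stepE M (t : 'I_T) (x : 'I_v) : layer_step M t x = M t x.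
Proof. by rewrite /layer_step !valK. Qed.

Lemma layer_step_out M t i : v <= i -> layer_step M t i = i.
Proof. by move=> vi; rewrite /layer_step; case: insubP => // t' _ _; rewrite insubF // ltnNge vi. Qed.

Lemma layer_step_high M t i : T <= t -> layer_step M t i = i.
Proof. by move=> Tt; rewrite /layer_step insubF // ltnNge Tt. Qed.

Lemma layer_step_lt M t i : (layer_step M t i < v) = (i < v).
Proof.
rewrite /layer_step; case: insubP => // t' _ _; case: insubP => //= x iv _.
by rewrite iv ltn_ord.
Qed.

Lemma layer_step_inj M t : injective (layer_step M t).
Proof.
move=> i j; have [iv|iv] := ltnP i v; have [jv|jv] := ltnP j v.
- rewrite /layer_step; case: insubP => // t' _ _.
  by rewrite (insubT (fun i => i < v) iv) (insubT (fun i => i < v) jv) => /val_inj/perm_inj/(congr1 val).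
- by move=> e; have := layer_step_lt M t i; rewrite e layer_step_lt iv ltnNge jv.
- by move=> e; have := layer_step_lt M t i; rewrite e layer_step_lt jv ltnNge iv.
- by rewrite !layer_step_out.
Qed.

Lemma layer_map_lt M t i : (layer_map M t i < v) = (i < v).
Proof. by elim: t => //= t IH; rewrite layer_step_lt. Qed.

Lemma layer_map_out M t i : v <= i -> layer_map M t i = i.
Proof. by move=> vi; elim: t => //= t ->; rewrite layer_step_out. Qed.

Lemma layer_map_inj M t : injective (layer_map M t).
Proof. by elim: t => // t IH i j /= /layer_step_inj/IH. Qed.

Lemma layer_map_high M t i : T <= t -> layer_map M t i = layer_map M T i.
Proof.
elim: t => [|t IH] Tt; first by case: (T) Tt.
move: Tt; rewrite leq_eqVlt => /orP[/eqP <- //|Tt].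
by rewrite /= layer_step_high // IH.
Qed.

Lemma path_pos_mod M p : path_pos M p %% L = p %% L.
Proof. by rewrite /path_pos modnMDl modn_mod. Qed.

Lemma path_pos_div M p : path_pos M p %/ L = layer_map M (p %% L) (p %/ L).
Proof. by rewrite /path_pos divnMDl // (divn_small (ltn_pmod _ L_gt0)) addn0. Qed.

Lemma path_pos_inj M : injective (path_pos M).
Proof.
move=> p q e; have em : p %% L = q %% L by rewrite -(path_pos_mod M p) e path_pos_mod.
have := path_pos_div M p; rewrite e path_pos_div em => /layer_map_inj ed.
by rewrite (divn_eq p L) em -ed -divn_eq.
Qed.

Lemma path_pos_out M p : v <= p %/ L -> path_pos M p = p.
Proof. by move=> vp; rewrite /path_pos layer_map_out // -divn_eq. Qed.

Lemma path_pos_lt M p : p < n -> path_pos M p < n.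
Proof.
move=> pn; have [vp|vp] := leqP v (p %/ L); first by rewrite path_pos_out.
apply: leq_trans n_large; rewrite -ltn_divLR // path_pos_div layer_map_lt //.
Qed.

Definition path_ord M (p : 'I_n) : 'I_n := Ordinal (path_pos_lt M (ltn_ord p)).

Lemma path_ord_inj M : injective (path_ord M).
Proof. by move=> p q /(congr1 val) /path_pos_inj/val_inj. Qed.

Definition layered_path M : 'S_n := perm (@path_ord_inj M).

Lemma layered_pathE M p : layered_path M p = path_pos M p :> nat.
Proof. by rewrite permE. Qed.

Lemma layered_path_inj : injective layered_path.
Proof.
move=> M M' e; have eq t i : t < L -> i < v -> layer_map M t i = layer_map M' t i.
  move=> tL iv; have pn : i * L + t < n.
    by apply: leq_trans n_large; rewrite -ltn_divLR // divnMDl // divn_small // addn0.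
  have := congr1 (fun s : 'S_n => val (s (Ordinal pn))) e; rewrite /= !layered_pathE.
  move/(congr1 (fun q => q %/ L)); rewrite !path_pos_div /=.
  by rewrite modnMDl modn_small // divnMDl // (divn_small tL) addn0.
apply/ffunP => t; apply/permP => x.
have tL : t.+1 < L by rewrite /L; have := ltn_ord t; lia.
have [y yE] : exists y : 'I_v, layer_map M t y = x.
  pose h (y : 'I_v) : 'I_v := insubd y (layer_map M t y).
  have hE y : h y = layer_map M t y :> nat by rewrite /h val_insubd layer_map_lt ltn_ord.
  have h_inj : injective h by move=> y z /(congr1 (@nat_of_ord v)); rewrite !hE => /layer_map_inj/val_inj.
  by exists (invF h_inj x); rewrite -hE f_invF.
have := eq t.+1 y tL (ltn_ord y); rewrite /= -(eq t y (ltnW tL) (ltn_ord y)) yE.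
by rewrite !layer_stepE => /val_inj.
Qed.

Definition composite M : {ffun 'I_v -> 'I_v} := [ffun x : 'I_v => insubd x (layer_map M T x)].

Lemma composite_eq M M' i : composite M = composite M' -> layer_map M T i = layer_map M' T i.
Proof.
have [vi|iv] := leqP v i; first by rewrite !layer_map_out.
move/ffunP/(_ (Ordinal iv))/(congr1 val); rewrite !ffunE !val_insubd /=.
by rewrite !layer_map_lt iv.
Qed.

(** Positions where all paths with the same composite have the same vertex ([frozen_eq]). *)
Definition frozen p := [|| T <= p %% L, p %% L == 0 | v <= p %/ L].
(** Positions on a return segment or in the tail. They are frozen together with their neighbours, so
    their vertices have degree at most two in the union of two paths with equal composites. *)
Definition fresh p := (T < p %% L) || (v <= p %/ L).

Lemma frozen_eq M M' p : composite M = composite M' -> frozen p -> path_pos M p = path_pos M' p.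
Proof.
move=> e /or3P[Tp|/eqP p0|vp].
- by rewrite /path_pos !(layer_map_high _ _ Tp) (composite_eq _ e).
- by rewrite /path_pos p0.
- by rewrite !path_pos_out.
Qed.

Lemma fresh_frozen p : fresh p -> frozen p.
Proof. by case/orP=> h; rewrite /frozen ?h ?orbT // ltnW. Qed.

Lemma fresh_frozenS p : fresh p -> frozen p.+1.
Proof.
rewrite /fresh /frozen modnS divnS //; case: ifP => _ /=; first by rewrite orbT.
by rewrite add0n => /orP[/ltnW/leqW ->|->]; rewrite ?orbT.
Qed.

Lemma fresh_frozenP p : fresh p.+1 -> frozen p.
Proof.
rewrite /fresh /frozen modnS divnS //; case: ifP => [h|_] /=; last first.
  by rewrite add0n ltnS => /orP[->|->]; rewrite ?orbT.
move=> _; apply/or3P/Or31; move: h; rewrite {1}(divn_eq p L) -addnS dvdn_addr ?dvdn_mull //.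
by move/(dvdn_leq (ltn0Sn _)); rewrite /L; lia.
Qed.

Definition path_adj M u w := exists2 p, p.+1 < n &
  (u = path_pos M p /\ w = path_pos M p.+1) \/ (w = path_pos M p /\ u = path_pos M p.+1).

Lemma path_adj_sym M u w : path_adj M u w -> path_adj M w u.
Proof. by case=> p pn h; exists p => //; case: h; [right|left]. Qed.

(** * A short cycle stays within the matched layers *)

Section Cycle.
Variables (M1 M2 : matchings) (F : nat -> nat).
Hypothesis M12 : composite M1 = composite M2.
Hypothesis F_lt : forall i, F i < n.
Hypothesis F_period : forall i, F (i + 2 * k) = F i.
Hypothesis F_inj : forall i j, F i = F j -> i = j %[mod 2 * k].
Hypothesis F_adj : forall i, path_adj M1 (F i) (F i.+1) \/ path_adj M2 (F i) (F i.+1).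

Let c := path_pos M1.
Let hit p := exists i, F i = c p.

Lemma F_periods m i : F (i + m * (2 * k)) = F i.
Proof. by elim: m i => [|m IH] i; rewrite ?addn0 // mulSn addnA IH F_period. Qed.

Lemma fresh_neighbours M p w : composite M1 = composite M -> fresh p -> path_adj M (c p) w ->
  (p.+1 < n /\ w = c p.+1) \/ (0 < p /\ w = c p.-1).
Proof.
move=> e fp; rewrite /c (frozen_eq e (fresh_frozen fp)) => -[q qn [[/path_pos_inj pq ->]|[-> /path_pos_inj pq]]].
  by left; rewrite pq (frozen_eq e) // -pq fresh_frozenS.
by right; rewrite pq /=; split=> //; rewrite (frozen_eq e) // fresh_frozenP // -pq.
Qed.

(** Both neighbours on the cycle are distinct, and only the two path neighbours are available. *)
Lemma hit_fresh p : fresh p -> hit p -> (p.+1 < n /\ hit p.+1) /\ hit p.-1.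
Proof.
move=> fp [i Fi].
have [j [Fj ji Aj]] : exists j, [/\ F j.+1 = c p, i.+1 <> j %[mod 2 * k] &
    path_adj M1 (F j) (F j.+1) \/ path_adj M2 (F j) (F j.+1)].
  (* The predecessor of [i] on the cycle, written without subtraction. *)
  exists (i + (2 * k).-1); split=> //.
    by rewrite -addnS prednK ?F_period //; lia.
  move/eqP; rewrite -addn1 eqn_modDl modn_small ?modn_small; lia.
have nb w : path_adj M1 (c p) w \/ path_adj M2 (c p) w ->
  (p.+1 < n /\ w = c p.+1) \/ (0 < p /\ w = c p.-1).
  by case=> /fresh_neighbours; apply.
have n1 := nb (F i.+1); have n2 := nb (F j).
rewrite -Fi in n1 *; have {}n1 := n1 (F_adj i).
have {}n2 : (p.+1 < n /\ F j = c p.+1) \/ (0 < p /\ F j = c p.-1).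
  by apply: n2; rewrite -Fj; case: Aj => /path_adj_sym; [left|right].
have ne w : ~ (F i.+1 = w /\ F j = w) by case=> <- /esym/F_inj.
case: n1 n2 => -[p1 h1] [] [p2 h2].
- by case: (ne (c p.+1)).
- by split; [split=> //; exists i.+1|exists j].
- by split; [split=> //; exists j|exists i.+1].
- by case: (ne (c p.-1)).
Qed.

(** The cycle would have to follow the tail beyond its last vertex. *)
Lemma no_hit_tail p : v <= p %/ L -> ~ hit p.
Proof.
have [m] := ubnP (n - p); elim: m p => // m IH p pm vp hp.
have fp : fresh p by rewrite /fresh vp orbT.
have [[pn /IH h] _] := hit_fresh fp hp; apply: h; first lia.
by apply: leq_trans vp _; apply: leq_div2r.
Qed.

(** The cycle would contain the whole return segment, which has [2 k + 1] vertices. *)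
Lemma no_hit_fresh p : fresh p -> ~ hit p.
Proof.
move=> fp hp; have [vp|pv] := leqP v (p %/ L); first exact: no_hit_tail hp.
have Tp : T < p %% L by move: fp; rewrite /fresh [v <= _]leqNgt pv orbF.
set i := p %/ L in pv; pose t0 := p %% L.
have fr t : T < t -> t < L -> fresh (i * L + t).
  by move=> Tt tL; rewrite /fresh modnMDl modn_small // Tt.
have hp0 : hit (i * L + t0) by rewrite -divn_eq.
have up t : t0 + t < L -> hit (i * L + (t0 + t)).
  elim: t => [|t IH] tL; first by rewrite addn0.
  have [||[_ h] _] := hit_fresh _ (IH _); [|lia|by rewrite !addnS].
  by apply: fr; [rewrite /t0; lia|lia].
have down t : T < t0 - t -> hit (i * L + (t0 - t)).
  elim: t => [|t IH] tT; first by rewrite subn0.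
  have tp : 0 < t0 - t by lia.
  have [||_] := hit_fresh _ (IH _); [|lia|].
    by apply: fr; [lia|have := ltn_pmod p L_gt0; rewrite -/t0; lia].
  by rewrite -subn1 -addnBA // -subnDA addn1.
have all t : T < t -> t < L -> hit (i * L + t).
  move=> Tt tL; have [h|h] := leqP t0 t; first by rewrite -(subnKC h); apply: up; lia.
  by rewrite (_ : t = t0 - (t0 - t)); [apply: down|]; lia.
have ex (s : 'I_(2 * k).+1) : exists j : 'I_(2 * k), F j = c (i * L + (T.+1 + s)).
  have [||j Fj] := all (T.+1 + s); [lia|by have := ltn_ord s; rewrite /L; lia|].
  have k2 : 0 < 2 * k by lia.
  by exists (Ordinal (ltn_pmod j k2)); rewrite -Fj /= [in RHS](divn_eq j (2 * k)) addnC F_periods.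
have [J JP] := fin_all_exists ex.
have J_inj : injective J.
  move=> s s' e; have := JP s; rewrite e JP => /path_pos_inj/addnI/addnI e'.
  exact: val_inj.
by have := leq_card J J_inj; rewrite !card_ord ltnn.
Qed.

Lemma cycle_vertex i : F i %/ L < v /\ F i %% L <= T.
Proof.
have [p pE] : exists p : 'I_n, path_ord M1 p = Ordinal (F_lt i).
  by exists (invF (@path_ord_inj M1) (Ordinal (F_lt i))); rewrite f_invF.
have {}pE : path_pos M1 p = F i by have := congr1 val pE.
have := @no_hit_fresh p; rewrite -pE path_pos_mod path_pos_div layer_map_lt.
rewrite /fresh; case: ltnP => [Tp|pT].
  by move=> h; case: h => //; exists i.
case: leqP => vp // h; case: h => //; by exists i.
Qed.

Lemma cycle_edge i : exists (M : matchings) (t : 'I_T), (M = M1 \/ M = M2) /\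
  ((F i %% L = t /\ F i.+1 %% L = t.+1 /\ F i.+1 %/ L = layer_step M t (F i %/ L)) \/
   (F i.+1 %% L = t /\ F i %% L = t.+1 /\ F i %/ L = layer_step M t (F i.+1 %/ L))).
Proof.
have [v0 t0] := cycle_vertex i; have [v1 t1] := cycle_vertex i.+1.
have key M u w p : u = path_pos M p -> w = path_pos M p.+1 -> u %/ L < v ->
    w %% L <= T -> u %% L <= T ->
    exists t : 'I_T, u %% L = t /\ w %% L = t.+1 /\ w %/ L = layer_step M t (u %/ L).
  move=> -> ->; rewrite !path_pos_mod !path_pos_div layer_map_lt.
  rewrite modnS divnS // => pv; case: ifP => [d|d] /= wT uT.
    (* A step that wraps round to layer 0 leaves from layer [L - 1], which exceeds [T]. *)
    have : L <= (p %% L).+1.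
      apply: dvdn_leq => //; move: d.
      by rewrite {1}(divn_eq p L) -addnS dvdn_addr ?dvdn_mull.
    by move/leq_trans => /(_ T.+1 uT); rewrite /L; lia.
  by exists (Ordinal wT); rewrite /= add0n.
case: (F_adj i) => -[p _ [[h1 h2]|[h1 h2]]].
- by have [t ht] := key M1 _ _ p h1 h2 v0 t1 t0; exists M1, t; split; [left|left].
- by have [t ht] := key M1 _ _ p h1 h2 v1 t0 t1; exists M1, t; split; [left|right].
- by have [t ht] := key M2 _ _ p h1 h2 v0 t1 t0; exists M2, t; split; [right|left].
- by have [t ht] := key M2 _ _ p h1 h2 v1 t0 t1; exists M2, t; split; [right|right].
Qed.

End Cycle.

Section CycleFree.
Variables (d : nat) (g : 'I_T * 'I_d -> {perm 'I_v}).
Hypothesis g_free : alternating_free k (fun c x => g c x).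

(* Edges always lead from an even to an odd layer, so that a path through the
   layers alternates between the two sides of the bipartite graph of [g]. *)
Definition admissible (t : 'I_T) : {set {perm 'I_v}} :=
  [set M : {perm 'I_v} | [forall x, exists c, if odd t then x == g (t, c) (M x)
                                               else M x == g (t, c) x]].

(** The rows along the cycle form a closed walk. A colour of [g] includes its layer, so two
    consecutive edges of the same colour would lead back to the vertex two steps before, which
    differs since [2 k > 2]. *)
Lemma layered_paths_cycle_free M1 M2 :
  (forall t, M1 t \in admissible t) -> (forall t, M2 t \in admissible t) ->
  composite M1 = composite M2 ->
  ~ contains_cycle (2 * k) (ham_edges (layered_path M1) :|: ham_edges (layered_path M2)).
Proof.
move=> adm1 adm2 M12 [f [f_inj f_edge]].
have k2 : 0 < 2 * k by lia.
pose F (i : nat) : nat := f (Ordinal (ltn_pmod i k2)).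
have F_lt i : F i < n by apply: ltn_ord.
have F_inj i j : F i = F j -> i = j %[mod 2 * k] by move=> /val_inj/f_inj/(congr1 val).
have F_eq i j : i = j %[mod 2 * k] -> F i = F j.
  by move=> e; rewrite /F; congr (nat_of_ord (f _)); apply: val_inj.
have F_period i : F (i + 2 * k) = F i by apply: F_eq; rewrite modnDr.
have F_adj i : path_adj M1 (F i) (F i.+1) \/ path_adj M2 (F i) (F i.+1).
  have /f_edge : val (Ordinal (ltn_pmod i.+1 k2)) == ((val (Ordinal (ltn_pmod i k2))).+1 %% (2 * k)).
    by rewrite /= -[i.+1]addn1 -[(_ %% _).+1]addn1 modnDml.
  have to_adj M : [set f (Ordinal (ltn_pmod i k2)); f (Ordinal (ltn_pmod i.+1 k2))]
       \in ham_edges (layered_path M) -> path_adj M (F i) (F i.+1).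
    case/mem_ham_edges => p [q [qp h]]; have pn : (val p).+1 < n by rewrite -qp ltn_ord.
    exists (val p) => //; rewrite -qp /F.
    by case: h => -[-> ->]; rewrite !layered_pathE; [left|right].
  by rewrite inE => /orP[/to_adj|/to_adj]; [left|right].
have vtx := cycle_vertex M12 F_lt F_period F_inj F_adj.
have edg := cycle_edge M12 F_lt F_period F_inj F_adj.
pose t i := F i %% L.
have yv i : F i %/ L < v by case: (vtx i).
pose y i : 'I_v := Ordinal (yv i).
pose col_ok i (c : 'I_T * 'I_d) := (minn (t i) (t i.+1) == c.1 :> nat) &&
  (if odd (t i) then y i == g c (y i.+1) else y i.+1 == g c (y i)).
have ex i : exists c, col_ok i c.
  have [M [s [M_or h]]] := edg i.
  have /forallP adm : [forall x, exists c, if odd s then x == g (s, c) (M s x) else M s x == g (s, c) x].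
    by case: M_or => ->; [have := adm1 s|have := adm2 s]; rewrite inE.
  case: h => -[ts [ts' ys]].
    have yE : y i.+1 = M s (y i) by apply: ord_inj; rewrite -layer_stepE; apply: ys.
    have /existsP[c hc] := adm (y i); exists (s, c); rewrite /col_ok /t ts ts' yE /=.
    by rewrite (minn_idPl (leqnSn _)) eqxx.
  have yE : y i = M s (y i.+1) by apply: ord_inj; rewrite -layer_stepE; apply: ys.
  have /existsP[c hc] := adm (y i.+1); exists (s, c); rewrite /col_ok /t ts ts' yE /=.
  by rewrite (minn_idPr (leqnSn _)) eqxx; case: (odd s) hc.
pose col i := xchoose (ex i).
have colP i : col_ok i (col i) by apply: xchooseP.
have tS i : t i.+1 = (t i).+1 \/ t i = (t i.+1).+1.
  by have [M [s [_ [[h1 [h2 _]]|[h1 [h2 _]]]]]] := edg i; rewrite /t h1 h2; [left|right].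
have odd_t i : odd (t i.+1) = ~~ odd (t i).
  by case: (tS i) => ->; rewrite /= ?negbK.
(* Shifting by [o] makes the walk start in an even layer, as the form of [alternating_free]
   requires. *)
pose o : nat := odd (t 0).
have odd_tb b : odd (t (b + o)) = odd b.
  elim: b => [|b IH]; last by rewrite addSn odd_t IH.
  by rewrite add0n /o; case E: (odd (t 0)); rewrite ?odd_t E.
have Feq i j : t i = t j -> y i = y j -> F i = F j.
  by move=> tij /(congr1 val) /= yij; rewrite (divn_eq (F i) L) (divn_eq (F j) L) yij -/(t i) tij.
apply: (g_free (y := fun b => y (b + o)) (c := fun b => col (b + o))).
- move=> a _; have /andP[_] := colP (2 * a + o); rewrite odd_tb mul2n odd_double.
  by move/eqP; rewrite addSn.
- move=> a _; have /andP[_] := colP ((2 * a).+1 + o); rewrite odd_tb oddS mul2n odd_double /=.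
  by move/eqP; rewrite !addSn.
- move=> b _ eqc; have /andP[/eqP m1 c1] := colP (b + o); have /andP[/eqP m2 c2] := colP (b.+1 + o).
  have tt : t (b + o) = t (b + o).+2.
    by move: m1 m2; rewrite eqc addSn => <-; case: (tS (b + o)); case: (tS (b + o).+1); lia.
  have yy : y (b + o) = y (b + o).+2.
    move: c1 c2; rewrite addSn odd_t -eqc.
    case: (odd _) => /= /eqP + /eqP; first by move=> -> ->.
    by move=> -> /perm_inj.
  have := F_inj _ _ (Feq _ _ tt yy); move/eqP.
  by rewrite -(addn2 (b + o)) -{1}[b + o]addn0 eqn_modDl mod0n modn_small //; lia.
- by apply: ord_inj; rewrite /= addnC F_period.
Qed.

End CycleFree.

Lemma card_admissible m (g : 'I_T * 'I_(2 ^ m) -> {perm 'I_v}) t :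
  alternating_free k (fun c x => g c x) -> (2 ^ m) ^ v <= #|admissible g t| * 16 ^ v.
Proof.
move=> gf; have g_inj (x : 'I_v) : injective (fun c => g (t, c) x).
  (* A double edge, traversed back and forth with alternating colours, would be a closed walk
     without backtracking. *)
  move=> c c' e; apply/eqP/negPn/negP => cc'.
  apply: (gf (fun b => if odd b then g (t, c) x else x) (fun b => (t, if odd b then c' else c))) => /=.
  - by move=> a _; rewrite mul2n odd_double.
  - by move=> a _; rewrite mul2n /= odd_double /= -e.
  - by move=> b _ /(congr1 snd) /=; case: (odd b) => /= e'; move: cc'; rewrite e' eqxx.
  - by rewrite mul2n odd_double.
have := @card_perfect_matchings _ m (fun c => g (t, c)) g_inj; rewrite card_ord.
move/leq_trans; apply; rewrite leq_mul2r; apply/orP; right.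
have [odt|odt] := boolP (odd t); last first.
  by apply: subset_leq_card; apply/subsetP => M; rewrite !inE (negbTE odt).
rewrite -(card_imset _ (@invg_inj _)); apply: subset_leq_card.
apply/subsetP => _ /imsetP[M + ->]; rewrite !inE odt => /forallP h; apply/forallP => x.
by have /existsP[c /eqP hc] := h (M^-1%g x); apply/existsP; exists c; rewrite -hc permKV.
Qed.

(** The factor [v ^ v] is the pigeonhole loss for a common composite. *)
Lemma cycle_intersecting_bound m (g : 'I_T * 'I_(2 ^ m) -> {perm 'I_v})
    (F : {set {set {set 'I_n}}}) :
  0 < v -> alternating_free k (fun c x => g c x) -> cycle_intersecting (2 * k) F ->
  #|F| * (2 ^ m) ^ (v * T) <= n`! * v ^ v * 16 ^ (v * T).
Proof.
move=> v0 g_free Fc; set d := 2 ^ m.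
pose X : {set matchings} := [set M : matchings | [forall t, M t \in admissible g t]].
have cX : d ^ (v * T) <= #|X| * 16 ^ (v * T).
  have -> : #|X| = \prod_t #|admissible g t|.
    transitivity #|family (fun t : 'I_T => mem (admissible g t))|.
      by apply: eq_card => M; rewrite inE; apply/forallP/familyP.
    by rewrite card_family foldrE big_image.
  have cst (a : nat) : a ^ (v * T) = \prod_(t < T) a ^ v by rewrite prod_nat_const card_ord expnM.
  rewrite !cst -big_split /=; apply: leq_prod => t _.
  exact: (card_admissible t g_free).
have [key Xkey] := pigeonhole X composite [ffun=> Ordinal v0].
rewrite card_ffun card_ord in Xkey.
pose Y := [set M in X | composite M == key].
have bound : #|F| * #|Y| <= n`!.
  rewrite -(card_imset _ layered_path_inj); apply: (ham_family_bound Fc).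
  move=> _ _ /imsetP[M1 + ->] /imsetP[M2 + ->].
  rewrite !inE => /andP[/forallP h1 /eqP e1] /andP[/forallP h2 /eqP e2].
  by apply: (layered_paths_cycle_free g_free h1 h2); rewrite e1 e2.
apply: leq_trans (leq_mul (leqnn _) cX) _.
apply: leq_trans (leq_mul (leqnn _) (leq_mul Xkey (leqnn _))) _.
by rewrite !mulnA !leq_mul2r bound !orbT.
Qed.

End LayeredPaths.

(** The graph is replaced by [c] disjoint copies, so that it can fill most of the [n] vertices, and
    [T * 2 ^ m] of its colours are distributed over the [T] pairs of layers. *)
Lemma cycle_intersecting_bound_copies k T m n c D (V : finType) (g : 'I_D -> V -> V)
    (F : {set {set {set 'I_n}}}) :
  2 <= k -> 0 < #|V| * c -> (forall i, injective (g i)) -> alternating_free k g ->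
  T * 2 ^ m <= D -> #|V| * c * (T + (2 * k).+2) <= n -> cycle_intersecting (2 * k) F ->
  #|F| * (2 ^ m) ^ (#|V| * c * T) <= n`! * (#|V| * c) ^ (#|V| * c) * 16 ^ (#|V| * c * T).
Proof.
move=> k2; pose W : finType := (V * 'I_c)%type.
have cW : #|W| = #|V| * c by rewrite card_prod card_ord.
rewrite -cW => W0 g_inj g_free dD nL Fc.
have cC : #|{: 'I_T * 'I_(2 ^ m)}| <= D by rewrite card_prod !card_ord.
pose color (tc : 'I_T * 'I_(2 ^ m)) := widen_ord cC (enum_rank tc).
have color_inj : injective color by move=> s t /(congr1 val) /= /val_inj/enum_rank_inj.
pose h tc (x : 'I_#|W|) : 'I_#|W| :=
  enum_rank ((g (color tc) (enum_val x).1, (enum_val x).2) : W).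
have h_inj tc : injective (h tc).
  move=> x y /enum_rank_inj [e1 e2]; apply: enum_val_inj.
  by rewrite [enum_val x]surjective_pairing [enum_val y]surjective_pairing (g_inj _ _ _ e1) e2.
apply: (@cycle_intersecting_bound k T #|W| n k2 nL m (fun tc => perm (h_inj tc)) F W0 _ Fc).
move=> y col up down colN ycl.
apply: (g_free (fun b => (enum_val (y b)).1) (fun b => color (col b))).
- by move=> a ak; rewrite up // permE enum_rankK.
- by move=> a ak; rewrite down // permE enum_rankK.
- by move=> b bk /color_inj; apply: colN.
- by rewrite ycl.
Qed.

(** * Primes and asymptotics *)

(** Legendre's formula: each power [p ^ j <= h + h] contributes at most 1 to the exponent, and
    higher powers contribute nothing. *)
Lemma logn_binomial_le p h : prime p -> 0 < h -> p ^ logn p 'C(h + h, h) <= h + h.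
Proof.
move=> p_pr h0; have p1 := prime_gt1 p_pr.
have bf := @bin_fact (h + h) h (leq_addr _ _); rewrite addnK in bf.
have C0 : 0 < 'C(h + h, h) by rewrite bin_gt0 leq_addr.
have := congr1 (logn p) bf; rewrite !lognM ?muln_gt0 ?fact_gt0 // !logn_fact //.
set N := h + h; set l := trunc_log p N => lE.
have Nl : N < p ^ l.+1 by apply: trunc_log_ltn.
have lN : p ^ l <= N by apply: trunc_logP; rewrite // /N addn_gt0 h0.
suff : logn p 'C(N, h) <= l by move=> cl; apply: leq_trans lN; rewrite leq_exp2l.
have big0 M j : M <= N -> l < j -> M %/ p ^ j = 0.
  move=> MN lj; rewrite divn_small // (leq_ltn_trans MN) // (leq_trans Nl) //.
  by rewrite leq_exp2l.
have sumE M : M <= N -> \sum_(1 <= j < M.+1) M %/ p ^ j = \sum_(1 <= j < l.+1) M %/ p ^ j.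
  move=> MN; have zero a b : M <= a \/ l <= a -> \sum_(a.+1 <= j < b) M %/ p ^ j = 0.
    move=> al; rewrite big_nat big1 // => j /andP[aj _]; case: al => al.
      by rewrite divn_small // (leq_ltn_trans al) // (ltn_trans aj) // ltn_expl.
    by apply: big0 => //; apply: leq_ltn_trans aj.
  have [Ml|lM] := leqP M l.
    by rewrite [RHS](@big_cat_nat _ _ _ M.+1) //= (zero M) ?addn0 //; left.
  by rewrite (@big_cat_nat _ _ _ l.+1) //= ?(zero l) ?addn0 //; [right|exact: ltnW].
move: lE; rewrite !sumE ?leq_addr // => lE.
have : \sum_(1 <= j < l.+1) N %/ p ^ j <= \sum_(1 <= j < l.+1) (h %/ p ^ j + h %/ p ^ j + 1).
  apply: leq_sum => j _; rewrite /N divnD ?expn_gt0 ?prime_gt0 // leq_add2l.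
  exact: leq_b1.
by rewrite -lE !big_split /= sum_nat_const_nat subSS subn0 muln1; lia.
Qed.

(* A weak form of Chebyshev's theorem: the central binomial coefficient is at
   least [2 ^ h], while each prime contributes at most a factor [h + h]. *)
Lemma prime_between y h : 0 < h -> (h + h) ^ y < 2 ^ h ->
  exists2 p, prime p & y < p <= h + h.
Proof.
move=> h0 hy; have C0 : 0 < 'C(h + h, h) by rewrite bin_gt0 leq_addr.
case: (boolP [exists p : 'I_(h + h).+1, prime p && (y < p)]) => [/existsP[p /andP[pp yp]]|no].
  by exists (val p) => //; rewrite yp -ltnS ltn_ord.
have : 2 ^ h <= 'C(h + h, h).
  have lb j : j <= h -> 2 ^ j * (h`! * j`!) <= (h + j)`!.
    elim: j => [|j IH] jh; first by rewrite mul1n muln1 addn0.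
    have -> : 2 ^ j.+1 * (h`! * j.+1`!) = 2 * j.+1 * (2 ^ j * (h`! * j`!)).
      by rewrite expnS factS; lia.
    by rewrite addnS factS leq_mul ?IH ?(ltnW jh) //; lia.
  have := lb h (leqnn h); have := @bin_fact (h + h) h (leq_addr _ _); rewrite addnK => <-.
  by rewrite leq_pmul2r // muln_gt0 fact_gt0.
(* Otherwise every prime factor of the binomial is at most [y], so the binomial is at most
   [(h + h) ^ y]. *)
rewrite leqNgt => /negP[]; apply: leq_ltn_trans hy.
rewrite -(@partnT 'C(h + h, h)) // /partn.
apply: (@leq_trans (\prod_(0 <= p < 'C(h + h, h).+1) (h + h) ^ (0 < p <= y))).
  apply: leq_prod => p _; have [pp|np] := boolP (prime p); last first.
    by rewrite lognE (negbTE np) /= expn_gt0 addn_gt0 h0.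
  have [l0|l0] := posnP (logn p 'C(h + h, h)); first by rewrite l0 expn_gt0 addn_gt0 h0.
  have pN : p <= h + h.
    apply: leq_trans (logn_binomial_le pp h0).
    exact: (leq_pexp2l (prime_gt0 pp) l0).
  have -> : 0 < p <= y.
    rewrite prime_gt0 //= leqNgt; apply: contra no => yp; apply/existsP.
    by exists (inord p); rewrite inordK ?ltnS // pp.
  by rewrite expn1 logn_binomial_le.
rewrite -expn_sum leq_pexp2l ?addn_gt0 ?h0 //.
have cnt n : \sum_(0 <= p < n) (0 < p <= y) <= minn n.-1 y.
  elim: n => [|n IH]; first by rewrite big_geq.
  by rewrite big_nat_recr //=; move: IH; case: ltnP => //=; case: (leqP n y); lia.
exact: leq_trans (cnt _) (geq_minr _ _).
Qed.

(** * Choice of parameters and passage to the limit *)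

Section Asymptotics.
Local Open Scope R_scope.

Lemma INR_expn (m n : nat) : INR (m ^ n)%N = INR m ^ n.
Proof. by elim: n => // n IH; rewrite expnS mult_INR IH. Qed.

Lemma INR_leq (m n : nat) : (m <= n)%N -> INR m <= INR n.
Proof. by move/leP/le_INR. Qed.

Lemma leq_INR (m n : nat) : INR m <= INR n -> (m <= n)%N.
Proof. by move/INR_le/leP. Qed.

Lemma INR_gt0 n : (0 < n)%N -> 0 < INR n.
Proof. by move/ltP/lt_0_INR. Qed.

Lemma ln_le_mono x y : 0 < x -> x <= y -> ln x <= ln y.
Proof. by move=> x0 [xy|->]; [left; apply: ln_increasing|right]. Qed.

Lemma nat_above A : exists N : nat, A <= INR N.
Proof.
have [N hN] := INR_unbounded A; exists N; lra.
Qed.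

Lemma ln_eventually A : exists N, forall n, (N <= n)%N -> (0 < n)%N /\ A <= ln (INR n).
Proof.
have [N hN] := nat_above (exp A); exists N => n Nn.
have h : exp A <= INR n by have := INR_leq Nn; lra.
have e0 := exp_pos A; split.
  by case: n h {Nn} => //= h; lra.
by rewrite -(ln_exp A); apply: ln_le_mono.
Qed.

Lemma floor_nat x : 0 <= x -> exists m : nat, INR m <= x < INR m + 1.
Proof.
move=> x0; pose P n := if Rlt_dec x (INR n) then true else false.
have exP : exists n, P n.
  have [n hn] := nat_above (x + 1); exists n; rewrite /P; case: Rlt_dec => // h; lra.
case: (ex_minnP exP) => [[|n]]; rewrite {1}/P; case: Rlt_dec => //= h _ nmin; first lra.
exists n; have : ~~ P n by apply/negP => /nmin; rewrite ltnn.
rewrite /P; case: Rlt_dec => // h' _; have := S_INR n; rewrite /=; lra.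
Qed.

(** [prime_between] is applied with [y] and [h] the integer parts of [x ^ (1 - delta)] and [x / 2];
    for large [x], [x ^ (1 - delta) * ln x] is below [x / 8]. *)
Lemma prime_near_power (delta : R) : 0 < delta < 1 -> exists X : nat, forall x : nat, (X <= x)%N ->
  exists2 p, prime p & (p <= x)%N /\ (1 - delta) * ln (INR x) <= ln (INR p).
Proof.
move=> [d0 d1]; have [X hX] := ln_eventually (32 / delta ^ 2 + 4); exists X => x /hX[x0 lx].
have d2 : 0 < delta ^ 2 by nra.
have q0 : 0 < 32 / delta ^ 2 by apply: Rdiv_lt_0_compat; lra.
set u := ln (INR x) in lx *.
have xe : INR x = exp u by rewrite /u exp_ln //; apply: INR_gt0.
have x5 : 5 <= INR x by rewrite xe; have := exp_ineq1_le u; lra.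
have [y [y1 y2]] := floor_nat (Rlt_le _ _ (exp_pos ((1 - delta) * u))).
pose h := (x./2)%N.
have xh : x = (odd x + (h + h))%N by rewrite addnn odd_double_half.
have hR : INR x <= 2 * INR h + 1.
  rewrite {1}xh plus_INR plus_INR; case: (odd x) => /=; lra.
have hx : 2 * INR h <= INR x.
  rewrite {1}xh plus_INR plus_INR; case: (odd x) => /=; lra.
have h0 : (0 < h)%N by apply/ltP/INR_lt => /=; lra.
have [|p pp /andP[yp pN]] := @prime_between y h h0.
  apply/ltP/INR_lt; rewrite !INR_expn plus_INR.
  apply: ln_lt_inv; try by apply: pow_lt; have := INR_gt0 h0; simpl; lra.
  have i2 : INR 2 = 2 by [].
  have hh0 := INR_gt0 h0.
  rewrite !ln_pow ?i2; try lra.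
  have l1 : ln (INR h + INR h) <= u by apply: ln_le_mono; lra.
  have l2 : / 2 < ln 2 by exact: ln_lt_2.
  have yu : INR y * ln (INR h + INR h) <= exp ((1 - delta) * u) * u.
    apply: Rmult_le_compat => //; first exact: pos_INR.
    by rewrite -ln_1; apply: ln_le_mono; lra.
  have eu : exp ((1 - delta) * u) * exp (delta * u) = exp u by rewrite -exp_plus; congr exp; lra.
  have sq : exp (delta * u) = exp (delta * u / 2) * exp (delta * u / 2).
    by rewrite -exp_plus; congr exp; lra.
  have u4 : 4 <= u by lra.
  have du : 0 < delta * u by apply: Rmult_lt_0_compat; lra.
  have g1 := exp_ineq1_le (delta * u / 2).
  have g2 : (delta * u) * (delta * u) / 4 < exp (delta * u) by rewrite sq; nra.
  have g3 : 32 <= delta ^ 2 * u.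
    have -> : 32 = delta ^ 2 * (32 / delta ^ 2).
      by rewrite /Rdiv Rmult_comm Rmult_assoc Rinv_l; lra.
    by apply: Rmult_le_compat_l; lra.
  have g4 : 8 * u < exp (delta * u).
    apply: Rle_lt_trans g2.
    have -> : delta * u * (delta * u) / 4 = (delta ^ 2 * u) * u / 4 by lra.
    nra.
  have g5 : exp ((1 - delta) * u) * u < INR x / 8.
    rewrite xe -eu; have := exp_pos ((1 - delta) * u); nra.
  have : INR x / 4 <= INR h by lra.
  nra.
exists p => //; split; first by rewrite xh (leq_trans pN) // leq_addl.
rewrite -(ln_exp ((1 - delta) * u)); apply: ln_le_mono; first exact: exp_pos.
have : INR y.+1 <= INR p by apply: INR_leq.
by rewrite S_INR; lra.
Qed.

Lemma dense_alternating_free (k T : nat) (delta : R) : (2 <= k)%N -> (0 < T)%N -> 0 < delta < 1 ->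
  exists (C : R) (N : nat), forall n, (N <= n)%N ->
  exists (V : finType) D (g : 'I_D -> V -> V) (c m : nat),
    [/\ forall i, injective (g i), alternating_free k g & (T * 2 ^ m <= D)%N] /\
    [/\ (0 < #|V| * c)%N, (#|V| * c * (T + (2 * k).+2) <= n)%N,
        (n * T <= #|V| * c * (T + (2 * k).+2) * T + n)%N &
        (1 - delta) * (2 / (3 * INR k)) * ln (INR n) - C <= ln (INR (2 ^ m))].
Proof.
move=> k2 T0 delta01; have [X hX] := prime_near_power delta01.
case: delta01 => d0 d1.
set L := (T + (2 * k).+2)%N.
have L0 : (0 < L)%N by rewrite /L addnS.
have K2 : 2 <= INR k by have := INR_leq k2; rewrite /=; lra.
set K := INR k in K2 *.
have TR : 0 < INR T by apply: INR_gt0.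
have LR : 0 < INR L by apply: INR_gt0.
have T1 : 1 <= INR T by have := INR_leq T0.
have L1 : 1 <= INR L by have := INR_leq L0.
(* [C0 * p ^ (3 k)] is the bound on [#|V| ^ 2], and [C1] leaves room for the factor [L * T] in
   [#|V| * L * T <= n]. *)
pose C0 := 64 * (50 * 3 ^ k) ^ 3.
have C0_1 : 1 <= C0.
  have p3 : 1 <= 3 ^ k by apply: pow_R1_Rle; lra.
  have : 1 ^ 3 <= (50 * 3 ^ k) ^ 3 by apply: pow_incr; lra.
  by rewrite /C0 pow1; lra.
pose C1 := C0 * (INR L * INR T) ^ 2.
have LT1 : 1 <= (INR L * INR T) ^ 2.
  have h : 1 <= INR L * INR T by nra.
  by have := pow_incr 1 _ 2 (conj Rle_0_1 h); rewrite pow1.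
have C1_1 : 1 <= C1 by rewrite /C1; nra.
have lC1 : 0 <= ln C1 by rewrite -ln_1; apply: ln_le_mono; lra.
(* [14409 = 3 * 4803] relates [p] to [D], and its double allows for rounding [D / T] down to a power
   of two. The lower bound [A] on [p] ensures [5 < p] and [T <= D]. *)
pose C2 := 28818 * INR T + 2.
pose A := 14409 * INR T + 6.
pose C := (1 - delta) * (ln C1 / (3 * K) + ln 2) + ln C2.
have q0 : 0 < / (1 - delta) by apply: Rinv_0_lt_compat; lra.
have A0 : 0 < A by rewrite /A; lra.
pose B := INR X + 2 + ln 2 + A / (1 - delta).
have [N hN] := ln_eventually (ln C1 + 3 * K * B); exists C, N => n /hN[n0].
set u := ln (INR n) => uB.
have l2 : 0 < ln 2 by rewrite -ln_1; apply: ln_increasing; lra.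
have nR : 0 < INR n by apply: INR_gt0.
have B0 : 0 < B.
  rewrite /B; have := pos_INR X; have : 0 < A / (1 - delta) by apply: Rmult_lt_0_compat.
  lra.
have u0 : 0 <= u by nra.
(* Chosen so that [C1 * exp (3 k z) = n ^ 2]; the prime is taken just below [exp z]. *)
pose z := (2 * u - ln C1) / (3 * K).
have zE : 3 * K * z = 2 * u - ln C1.
  by rewrite /z /Rdiv -Rmult_assoc (Rmult_comm (3 * K)) Rmult_assoc Rinv_r; lra.
have zB : B <= z.
  have h : 3 * K * B <= 3 * K * z by lra.
  by apply: Rmult_le_reg_l h; lra.
have [x [x1 x2]] := floor_nat (Rlt_le _ _ (exp_pos z)).
have Az0 : 0 < A / (1 - delta) by apply: Rmult_lt_0_compat.
have e1 := exp_ineq1_le z.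
have xX : (X <= x)%N.
  by apply: leq_INR; have := pos_INR X; move: zB; rewrite /B; lra.
have x_ge1 : 1 <= INR x by move: zB; rewrite /B; have := pos_INR X; lra.
have lx : z - ln 2 <= ln (INR x).
  have : ln (exp z) <= ln (2 * INR x) by apply: ln_le_mono; [exact: exp_pos|lra].
  by rewrite ln_exp ln_mult; lra.
have [p p_pr [px lp]] := hX x xX.
have pR : 0 < INR p by apply: INR_gt0; apply: prime_gt0.
have pA : A <= INR p.
  have h1 : (1 - delta) * (A / (1 - delta)) = A.
    by rewrite /Rdiv Rmult_comm Rmult_assoc Rinv_l; lra.
  have h2 : A / (1 - delta) <= ln (INR x) by move: zB; rewrite /B; have := pos_INR X; lra.
  have h3 : A <= ln (INR p).
    apply: Rle_trans lp; rewrite -{1}h1; apply: Rmult_le_compat_l; lra.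
  have := exp_ineq1_le (ln (INR p)); rewrite exp_ln //; lra.
have p5 : (5 < p)%N by apply: leq_INR; rewrite /=; move: pA; rewrite /A; lra.
have [V [D [g [g_inj g_free pD V0 V2]]]] := Quaternion.alternating_free_exists (ltnW k2) p_pr p5.
have pDR : INR p <= 14409 * INR D + 2.
  have : (p <= 3 * (D * 4803) + 2)%N by rewrite addnC -leq_subLR.
  move/INR_leq; rewrite plus_INR !mult_INR.
  have -> : INR 4803 = 4803 by rewrite INR_IZR_INZ.
  rewrite /=; lra.
have TD : (T <= D)%N by apply: leq_INR; move: pA; rewrite /A; lra.
have DT0 : (0 < D %/ T)%N by rewrite divn_gt0.
pose m := trunc_log 2 (D %/ T).
have mD : (T * 2 ^ m <= D)%N.
  apply: leq_trans (leq_trunc_div D T); rewrite mulnC leq_mul2r trunc_logP ?orbT //.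
have Dm : (D <= 2 * T * 2 ^ m)%N.
  have : (D %/ T < 2 ^ m.+1)%N by apply: trunc_log_ltn.
  by rewrite ltn_divLR // expnS => /ltnW; rewrite mulnAC.
have dR : 1 <= INR (2 ^ m).
  have : (1 <= 2 ^ m)%N by rewrite expn_gt0.
  by move/INR_leq.
have ld : ln (INR p) - ln C2 <= ln (INR (2 ^ m)).
  have C2p : 0 < C2 by rewrite /C2; lra.
  have : INR p <= C2 * INR (2 ^ m).
    have := INR_leq Dm; rewrite !mult_INR [INR 2]/= /C2 => h; nra.
  by move/(ln_le_mono pR); rewrite ln_mult; lra.
set v0 := #|V| in V0 V2.
have v0R : 0 < INR v0 by apply: INR_gt0.
have vLT : (v0 * L * T <= n)%N.
  apply: leq_INR; rewrite !mult_INR; apply: Rsqr_incr_0_var; last lra.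
  have h1 := INR_leq V2; rewrite !(INR_expn, mult_INR) in h1.
  have h64 : INR 64 = 64 by rewrite INR_IZR_INZ.
  have h50 : INR 50 = 50 by rewrite INR_IZR_INZ.
  have h3 : INR 3 = 3 by rewrite INR_IZR_INZ.
  rewrite h64 h50 h3 in h1.
  have h2 : INR v0 ^ 2 <= C0 * (INR p ^ k) ^ 3.
    apply: Rle_trans h1 _; rewrite /C0 Rpow_mult_distr.
    by rewrite -Rmult_assoc Rpow_mult_distr -Rmult_assoc; lra.
  have pz : INR p <= exp z by have := INR_leq px; lra.
  have h4 : (INR p ^ k) ^ 3 <= exp (2 * u - ln C1).
    have -> : exp (2 * u - ln C1) = (exp z ^ k) ^ 3.
      have ep (a : R) (j : nat) : exp a ^ j = exp (INR j * a).
        elim: j => [|j IH]; first by rewrite /= Rmult_0_l exp_0.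
        by rewrite S_INR /= IH -exp_plus; congr exp; lra.
      by rewrite !ep -zE; congr exp; rewrite h3 -/K; lra.
    apply: pow_incr; split; first by apply: pow_le; lra.
    by apply: pow_incr; lra.
  have h5 : exp (2 * u - ln C1) * C1 = INR n ^ 2.
    rewrite -{2}(exp_ln C1); last lra.
    rewrite -exp_plus (_ : 2 * u - ln C1 + ln C1 = u + u); last lra.
    by rewrite exp_plus /u exp_ln //=; lra.
  rewrite /Rsqr; have h6 : INR v0 ^ 2 * (INR L * INR T) ^ 2 <= INR n ^ 2.
    move: h4 h5; move: (exp (2 * u - ln C1)) => E h4 <-; rewrite /C1.
    apply: (Rle_trans _ (C0 * E * (INR L * INR T) ^ 2)); last lra.
    apply: Rmult_le_compat_r; first lra.
    by apply: Rle_trans h2 _; apply: Rmult_le_compat_l; lra.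
  by move: h6; rewrite /=; lra.
(* Rounding leaves fewer than [#|V| * L <= n / T] vertices outside the copies. *)
pose c := (n %/ (v0 * L))%N.
have v0L : (0 < v0 * L)%N by rewrite muln_gt0 V0.
have cT : (T <= c)%N by rewrite leq_divRL // mulnC.
exists V, D, g, c, m; rewrite -/v0 -/L; split; split=> //.
- by rewrite muln_gt0 V0 (leq_trans T0 cT).
- by rewrite mulnAC mulnC leq_trunc_div.
- have := ltn_ceil n v0L; rewrite -/c => h.
  apply: (@leq_trans (c.+1 * (v0 * L) * T)); first by rewrite leq_mul2r (ltnW h) orbT.
  rewrite mulSn mulnDl addnC leq_add //.
  by rewrite mulnA (mulnC c).
- rewrite -/u; have : (1 - delta) * (z - ln 2) <= (1 - delta) * ln (INR x) by apply: Rmult_le_compat_l; lra.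
  have -> : (1 - delta) * (2 / (3 * K)) * u - C = (1 - delta) * (z - ln 2) - ln C2.
    rewrite /C /z /Rdiv; lra.
  lra.
Qed.

Lemma fact_leq_expn n : (n`! <= n ^ n)%N.
Proof.
elim: n => // n IH; rewrite factS expnS leq_mul // (leq_trans IH) //.
by case: n {IH} => // n; rewrite leq_exp2r.
Qed.

Lemma hamilton_family_bound (k : nat) (eps : R) : (2 <= k)%N -> 0 < eps ->
  exists N : nat, forall n : nat, (N <= n)%N ->
  forall F : {set {set {set 'I_n}}}, cycle_intersecting (2 * k) F ->
  INR #|F| <= Rpower (INR n) ((1 - 2 / (3 * INR k) + eps) * INR n).
Proof.
move=> k2 eps0; set K := INR k.
have K2 : 2 <= K by have := INR_leq k2; rewrite /= /K; lra.
(* [T] is large enough that [(2 k + 4) / T <= eps / 4]: the share [(2 k + 3) / T] covers vertices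
   without a matching and rounding, and [1 / T] the common composite. *)
have [T hT] := nat_above (4 * (2 * K + 4) / eps + 1).
have q0 : 0 < 4 * (2 * K + 4) / eps by apply: Rdiv_lt_0_compat; lra.
have TR : 0 < INR T by lra.
have T0 : (0 < T)%N by apply/ltP/INR_lt => /=; lra.
pose delta := Rmin (eps / 4) (1 / 2).
have delta01 : 0 < delta < 1.
  have := Rmin_r (eps / 4) (1 / 2); have := Rmin_glb_lt (eps / 4) (1 / 2) 0.
  by rewrite /delta; lra.
have delta_eps : delta <= eps / 4 by apply: Rmin_l.
have [C [N1 hN1]] := dense_alternating_free k2 T0 delta01.
pose s0 := (1 - delta) * (2 / (3 * K)).
have s0E : s0 * (3 * K) = (1 - delta) * 2.
  by rewrite /s0 /Rdiv !Rmult_assoc Rinv_l; lra.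
have s0_0 : 0 < s0 by nra.
pose C4 := Rmax (C + ln 16) 0.
(* The first threshold keeps [s] nonnegative; the second absorbs the constants into [eps / 2]. *)
have [N2 hN2] := ln_eventually (Rmax (C4 / s0) (2 * C4 / eps)).
exists (maxn N1 N2) => n; rewrite geq_max => /andP[/hN1 + /hN2[n0]].
set u := ln (INR n) => -[V [D [g [c [m [[g_inj g_free mD] [v0 vL nT ld]]]]]]] uC F Fc.
have nR : 0 < INR n by apply: INR_gt0.
have [F0|F0] := posnP #|F|; first by rewrite F0 /=; left; apply: exp_pos.
have FR : 0 < INR #|F| by apply: INR_gt0.
have := cycle_intersecting_bound_copies k2 v0 g_inj g_free mD vL Fc.
set v := (#|V| * c)%N in v0 vL nT *; set d := (2 ^ m)%N in ld * => bound; clearbody v.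
have L0 : (0 < T + (2 * k).+2)%N by rewrite addnS.
have vn : (v <= n)%N by apply: leq_trans vL; rewrite leq_pmulr.
have vTn : (v * T <= n)%N by apply: leq_trans vL; rewrite leq_mul2l leq_addr orbT.
have dR : 0 < INR d by apply: INR_gt0; rewrite /d expn_gt0.
have lnb : ln (INR #|F|) + INR v * INR T * ln (INR d)
    <= INR n * u + INR v * u + INR v * INR T * ln 16.
  have h16 : INR 16 = 16 by rewrite INR_IZR_INZ.
  have {}bound : INR #|F| * INR d ^ (v * T) <= INR n ^ n * INR n ^ v * 16 ^ (v * T).
    rewrite -h16 -!INR_expn -!mult_INR; apply: INR_leq; apply: leq_trans bound _.
    rewrite leq_mul2r leq_mul ?orbT ?fact_leq_expn //.
    by rewrite leq_exp2r.
  have p1 : 0 < INR d ^ (v * T) by apply: pow_lt.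
  have p2 : 0 < INR n ^ n by apply: pow_lt.
  have p3 : 0 < INR n ^ v by apply: pow_lt.
  have p4 : 0 < 16 ^ (v * T) by apply: pow_lt; lra.
  have := ln_le_mono (Rmult_lt_0_compat _ _ FR p1) bound.
  rewrite (ln_mult _ _ FR p1) (ln_mult _ _ (Rmult_lt_0_compat _ _ p2 p3) p4).
  by rewrite (ln_mult _ _ p2 p3) !ln_pow ?(mult_INR v T) //; lra.
have KL : INR (T + (2 * k).+2) = INR T + 2 * K + 2.
  by rewrite plus_INR !S_INR mult_INR /= -/K; lra.
have := INR_leq nT; rewrite plus_INR !mult_INR KL => {}nT.
have := INR_leq vTn; rewrite mult_INR => {}vTn.
pose r := / INR T; have rT : INR T * r = 1 by rewrite /r Rinv_r; lra.
have r0 : 0 < r by apply: Rinv_0_lt_compat.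
set w := INR v * INR T in lnb vTn.
have vw : INR v = w * r by rewrite /w Rmult_assoc rT; lra.
pose eta := (2 * K + 3) * r.
have w_lower : INR n * (1 - eta) <= w.
  have LR : 0 < INR T + 2 * K + 2 by lra.
  apply: (Rmult_le_reg_r _ _ _ LR); apply: (Rle_trans _ (INR n * (INR T - 1))).
    rewrite Rmult_assoc; apply: Rmult_le_compat_l; first lra.
    have -> : (1 - eta) * (INR T + 2 * K + 2) =
       INR T + 2 * K + 2 - (2 * K + 3) * (INR T * r) - (2 * K + 3) * (2 * K + 2) * r.
      by rewrite /eta; lra.
    by rewrite rT; nra.
  rewrite /w; lra.
have r_eps : eta + r <= eps / 4.
  have -> : eta + r = (2 * K + 4) * r by rewrite /eta; lra.
  apply: (Rmult_le_reg_l (INR T) _ _ TR).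
  have -> : INR T * ((2 * K + 4) * r) = (2 * K + 4) * (INR T * r) by lra.
  rewrite rT; have : 4 * (2 * K + 4) / eps * eps = 4 * (2 * K + 4).
    by rewrite /Rdiv Rmult_assoc Rinv_l; lra.
  nra.
have C4_0 : 0 <= C4 by apply: Rmax_r.
have C4_C : C + ln 16 <= C4 by apply: Rmax_l.
have u1 : C4 <= s0 * u.
  have h : C4 / s0 <= u by apply: Rle_trans uC; apply: Rmax_l.
  have -> : C4 = s0 * (C4 / s0) by rewrite /Rdiv Rmult_comm Rmult_assoc Rinv_l; lra.
  by apply: Rmult_le_compat_l; lra.
have u2 : C4 <= eps / 2 * u.
  have h : 2 * C4 / eps <= u by apply: Rle_trans uC; apply: Rmax_r.
  have -> : C4 = eps / 2 * (2 * C4 / eps).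
    rewrite /Rdiv; have -> : eps * / 2 * (2 * C4 * / eps) = C4 * (/ eps * eps) by lra.
    by rewrite Rinv_l; lra.
  by apply: Rmult_le_compat_l; lra.
have u0 : 0 <= u by nra.
pose s := s0 * u - C4.
have s_0 : 0 <= s by rewrite /s; lra.
have ws : INR n * (1 - eta) * s <= w * (ln (INR d) - ln 16).
  apply: (Rle_trans _ (w * s)); first by apply: Rmult_le_compat_r.
  apply: Rmult_le_compat_l; first by rewrite /w; apply: Rmult_le_pos; apply: pos_INR.
  by move: ld; rewrite -/s0 /s; lra.
have eta0 : 0 <= eta by rewrite /eta; nra.
have s_u : s <= u.
  have : s0 <= 1 by nra.
  by rewrite /s; nra.
have es : (1 - eta) * s >= s0 * u - C4 - eta * u by rewrite /s in s_u *; nra.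
have s0_lower : 2 / (3 * K) - delta <= s0.
  have : 2 / (3 * K) <= 1.
    by apply: (Rmult_le_reg_r (3 * K)); [lra|rewrite /Rdiv Rmult_assoc Rinv_l; lra].
  have : 0 < 2 / (3 * K) by apply: Rdiv_lt_0_compat; lra.
  by rewrite /s0; nra.
have main : ln (INR #|F|) <= (1 - 2 / (3 * K) + eps) * INR n * u.
  have h1 : INR v * u <= INR n * (r * u).
    rewrite vw Rmult_assoc; apply: Rmult_le_compat_r => //.
    by apply: Rmult_le_pos; lra.
  have h2 : INR n * (s0 * u - C4 - eta * u) <= INR n * ((1 - eta) * s).
    by apply: Rmult_le_compat_l; lra.
  have h3 : (2 / (3 * K) - delta) * u <= s0 * u by apply: Rmult_le_compat_r.
  have h4 : (eta + r) * u <= eps / 4 * u by apply: Rmult_le_compat_r.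
  have h5 : delta * u <= eps / 4 * u by apply: Rmult_le_compat_r.
  have h6 : r * u + eta * u - s0 * u + C4 <= (eps - 2 / (3 * K)) * u by lra.
  have h7 : INR n * (r * u + eta * u - s0 * u + C4) <= INR n * ((eps - 2 / (3 * K)) * u).
    by apply: Rmult_le_compat_l; lra.
  lra.
rewrite -(exp_ln (INR #|F|)) // /Rpower -/u -/K.
by case: main => [/exp_increasing/Rlt_le|->]; [|right].
Qed.

End Asymptotics.

(* Imported again because the MathComp imports rebind the notations of the statement. *)
From Stdlib Require Import Reals.

(* H_n(C_{2k}) <= n^{(1 - 2/(3k)) n + o(n)}, stated as: for every eps > 0,
   for all large n, every admissible family F has
   #|F| <= n^{(1 - 2/(3k) + eps) n}. *)
Theorem theorem3 :
  forall k : nat, (2 <= k)%N ->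
  forall eps : R, (0 < eps)%R ->
  exists N : nat, forall n : nat, (N <= n)%N ->
  forall F : {set {set {set 'I_n}}}, cycle_intersecting (2 * k) F ->
  (INR #|F| <= Rpower (INR n) ((1 - 2 / (3 * INR k) + eps) * INR n))%R.
Proof. by move=> k k2 eps eps0; apply: hamilton_family_bound. Qed.
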